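(* Let $\sigma\in(0,1/2)$, $\tilde B>0$, and let $b$ be the function on the torus $\mathbb{T}^2$ given by $b(x,y)=0$ for $|x|\le\sigma$ and $b(x,y)=\tilde B$ for $\sigma<|x|\le1/2$. There exists $C_0>0$ such that the spectrum of the damped wave problem, i.e. the set of $z\in\mathbb{C}$ for which there is $u\in L^2(\mathbb{T}^2)$, $u\not\equiv0$, with $$P(z)u=0,\qquad P(z)=-\Delta+zb(x)+z^2,$$ contains an infinite subsequence $\{z_i\}$ such that $\mathrm{Im}\,z_i\to\infty$ and $$|\mathrm{Re}\,z_i|\le\frac{C_0}{(\mathrm{Im}\,z_i)^{3/2}}.$$
   Context: The torus $\mathbb{T}^2=(\mathbb{R}/\mathbb{Z})^2$ is identified with the square $\{-1/2\le x<1/2,\ 0\le y<1\}$ with periodic boundary conditions, and $\Delta$ is its flat Laplacian. The equation $P(z)u=0$ is understood with $u$ in the domain $H^2(\mathbb{T}^2)$. *)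

(* Defs.v *)
From HB Require Import structures.
From mathcomp Require Import all_boot all_order all_algebra.
From mathcomp Require Import all_classical all_reals all_analysis.
From mathcomp Require Import complex.
Set Implicit Arguments.
Unset Strict Implicit.
Unset Printing Implicit Defensive.
Import Order.TTheory GRing.Theory Num.Theory.
Import numFieldNormedType.Exports.
Local Open Scope classical_set_scope.
Local Open Scope ring_scope.

(* Functions on the torus are represented by functions on R * R of which only
   the values on the fundamental square matter; the periodic boundary
   conditions enter through the periodicity of the test functions. *)

Section Torus.
Variable R : realType.

Local Notation leb2 := (@lebesgue_measure R \x @lebesgue_measure R)%E.

Definition square : set (R * R) :=
  [set p | [/\ - 2^-1 <= p.1, p.1 < 2^-1, 0 <= p.2 & p.2 < 1]].

Definition ae_eq_torus (u v : R * R -> R[i]) : Prop :=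
  {ae leb2, forall p, square p -> u p = v p}.

Definition torus_int (f : R * R -> R[i]) : R[i] :=
  Complex (Rintegral leb2 square (fun p => complex.Re (f p)))
          (Rintegral leb2 square (fun p => complex.Im (f p))).

Definition L2 (u : R * R -> R[i]) : Prop :=
  [/\ measurable_fun square (fun p => complex.Re (u p)),
      measurable_fun square (fun p => complex.Im (u p)) &
      (\int[leb2]_(p in square) ((Normc.normc (u p)) ^+ 2)%:E < +oo)%E].

Definition dir (d : bool) : R * R := if d then (0, 1) else (1, 0).

Definition partial (d : bool) (f : R * R -> R) : R * R -> R :=
  fun p => 'D_(dir d) f p.

Definition smooth (f : R * R -> R) : Prop :=
  forall (s : seq bool) (p : R * R), differentiable (foldr partial f s) p.

Definition periodic (f : R * R -> R) : Prop :=
  forall x y, f (x + 1, y) = f (x, y) /\ f (x, y + 1) = f (x, y).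

Definition mderiv (j k : nat) (f : R * R -> R) : R * R -> R :=
  iter j (partial false) (iter k (partial true) f).

(* Real test functions suffice for complex-valued u and g: both sides of the
   identity extend complex-linearly in phi. *)
Definition weak_deriv (j k : nat) (u g : R * R -> R[i]) : Prop :=
  forall phi : R * R -> R, smooth phi -> periodic phi ->
    torus_int (fun p => u p * (mderiv j k phi p)%:C%C) =
    (-1) ^+ (j + k) * torus_int (fun p => g p * (phi p)%:C%C).

Definition H2 (u : R * R -> R[i]) : Prop :=
  L2 u /\ forall j k : nat, (j + k <= 2)%N ->
    exists2 g, L2 g & weak_deriv j k u g.

Definition is_laplacian (u w : R * R -> R[i]) : Prop :=
  exists uxx uyy : R * R -> R[i],
    [/\ L2 uxx /\ weak_deriv 2 0 u uxx, L2 uyy /\ weak_deriv 0 2 u uyy &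
        ae_eq_torus w (fun p => uxx p + uyy p)].

Definition damping (sigma B : R) (p : R * R) : R :=
  if `|p.1| <= sigma then 0 else B.

(* [damped_wave b z u f] reads P(z) u = f; it is a relation because functions
   on the torus are only determined almost everywhere. *)
Definition damped_wave (b : R * R -> R) (z : R[i])
    (u f : R * R -> R[i]) : Prop :=
  exists2 w, is_laplacian u w &
    ae_eq_torus (fun p => - w p + z * (b p)%:C%C * u p + z ^+ 2 * u p) f.

Definition spectrum (b : R * R -> R) : set R[i] :=
  [set z | exists u : R * R -> R[i],
    [/\ H2 u, ~ ae_eq_torus u (fun=> 0) & damped_wave b z u (fun=> 0)]].

End Torus.

(* Main.v *)
Require Import Defs.
From mathcomp Require Import all_boot all_order all_algebra.
From mathcomp Require Import all_classical all_reals all_analysis.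
From mathcomp Require Import complex.
From mathcomp Require Import measurable_realfun ring lra.
Import Order.TTheory GRing.Theory Num.Theory.
Import numFieldNormedType.Exports.
Local Open Scope classical_set_scope.
Local Open Scope ring_scope.

(** Separate variables: [u(x, y) = v(x) exp(i N y)] with [N = 2 pi n], where [v]
    is [cos(k x)] on [|x| <= sigma] and a multiple of [cosh(kappa (1/2 - |x|))]
    outside.  This is an eigenfunction as soon as
      [z^2 = - N^2 - k^2],  [kappa^2 = B z - k^2],
      [k tan(k sigma) = kappa tanh(kappa (1/2 - sigma))].
    As [|kappa|] grows like [N^(1/2)], the last equation forces
    [cos(k sigma) = O(N^(-1/2))], hence a root [k = pi/(2 sigma) + O(N^(-1/2))],
    found by contraction in the three unknowns [k], [z], [kappa] around
    [(pi/(2 sigma), i N, (i N B)^(1/2))].  Taking imaginary parts,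
    [2 Re z Im z = - Im (k^2) = O(N^(-1/2))], so [Re z = O(N^(-3/2))]. *)

(** The hyperbolic tangent enters as [(1 - E) / (1 + E)] with [E = exp(-2 kappa (1/2 - sigma))],
    which is tiny because [Re kappa] is large. Keeping [k], [z], [kappa] as three unknowns tied by
    polynomial relations avoids choosing branches of square roots: each difference of squares
    factors as [(w - w0) (w + w0)], and dividing by the large second factor turns the relation into
    a fixed-point equation for the deviation [w - w0] with a small right-hand side. The equation for
    [k] is different: its linear part is removed by hand, and the quadratic remainder of the sine
    contracts only on a small disc. The centre [pi/(2 sigma)] is the lowest Dirichlet wavenumber of
    the undamped strip; being real, it leaves all of [Im k] to the small correction.

    The mode is only C^1 in [x]: its second derivative jumps at [|x| = sigma] together with the
    damping. The equation is therefore checked with weak derivatives, where matching values and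
    slopes cancels the boundary terms. The mode is even in [x], so periodicity of its slope amounts
    to a vanishing slope at [x = 1/2], which the hyperbolic cosine centred there provides. *)

Set Implicit Arguments.
Unset Strict Implicit.

(** * The complex exponential *)

Notation nm := Normc.normc.

Section ComplexExp.
Context {R : realType}.
Implicit Types (x y : R) (a b c : R[i]).

Lemma nm_ge0 a : 0 <= nm a.
Proof. by case: a => ? ? /=; exact: sqrtr_ge0. Qed.

Lemma nm_sqr a : nm a ^+ 2 = complex.Re a ^+ 2 + complex.Im a ^+ 2.
Proof. by case: a => x y /=; rewrite sqr_sqrtr// addr_ge0// sqr_ge0. Qed.

Lemma nm_Re a : `|complex.Re a| <= nm a.
Proof.
rewrite -ler_sqr ?nnegrE ?nm_ge0// nm_sqr real_normK ?num_real// lerDl.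
exact: sqr_ge0.
Qed.

Lemma nm_Im a : `|complex.Im a| <= nm a.
Proof.
rewrite -ler_sqr ?nnegrE ?nm_ge0// nm_sqr real_normK ?num_real// lerDr.
exact: sqr_ge0.
Qed.

Lemma nm_le_ReIm a : nm a <= `|complex.Re a| + `|complex.Im a|.
Proof.
rewrite -ler_sqr ?nnegrE ?nm_ge0 ?addr_ge0// nm_sqr sqrrD !real_normK ?num_real//.
rewrite -addrA [X in _ <= _ + X]addrC addrA lerDl.
by rewrite mulrn_wge0// mulr_ge0.
Qed.

Lemma nm_real x : nm x%:C%C = `|x|.
Proof. by rewrite /= expr0n addr0 sqrtr_sqr. Qed.

Lemma nmD a b : nm (a + b) <= nm a + nm b. Proof. exact: le_normcD. Qed.

Lemma nmN a : nm (- a) = nm a. Proof. exact: normcN. Qed.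

Lemma nmB a b : nm (a - b) <= nm a + nm b.
Proof. by rewrite -(nmN b); exact: nmD. Qed.

Lemma nmBC a b : nm (a - b) = nm (b - a).
Proof. by rewrite -nmN opprB. Qed.

Lemma nm_subadd a b : nm a - nm b <= nm (a + b).
Proof. by rewrite lerBlDr -{1}(addrK b a); exact: nmB. Qed.

Lemma nmM a b : nm (a * b) = nm a * nm b. Proof. exact: Normc.normcM. Qed.

Lemma nmV a : nm a^-1 = (nm a)^-1. Proof. exact: Normc.normcV. Qed.

Lemma nm_gt0 a : (0 < nm a) = (a != 0).
Proof.
rewrite lt_def nm_ge0 andbT; congr negb; apply/eqP/eqP; last by move=> ->; exact: Normc.normc0.
exact: Normc.eq0_normc.
Qed.

Lemma cReM a b : complex.Re (a * b) =
  complex.Re a * complex.Re b - complex.Im a * complex.Im b.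
Proof. by case: a => ? ?; case: b. Qed.

Lemma cImM a b : complex.Im (a * b) =
  complex.Re a * complex.Im b + complex.Im a * complex.Re b.
Proof. by case: a => ? ?; case: b. Qed.

Lemma cReD a b : complex.Re (a + b) = complex.Re a + complex.Re b.
Proof. by case: a => ? ?; case: b. Qed.

Lemma cImD a b : complex.Im (a + b) = complex.Im a + complex.Im b.
Proof. by case: a => ? ?; case: b. Qed.

Lemma complex_eqP a b :
  complex.Re a = complex.Re b -> complex.Im a = complex.Im b -> a = b.
Proof. by case: a => ? ?; case: b => ? ? /= -> ->. Qed.

Definition cexp a : R[i] :=
  (expR (complex.Re a) * cos (complex.Im a)
   +i* (expR (complex.Re a) * sin (complex.Im a)))%C.

Lemma cexp0 : cexp 0 = 1.
Proof. by rewrite /cexp /= expR0 cos0 sin0 mulr1 mulr0. Qed.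

Lemma cexpD a b : cexp (a + b) = cexp a * cexp b.
Proof.
apply: complex_eqP; rewrite ?cReM ?cImM /= cReD cImD expRD ?cosD ?sinD; ring.
Qed.

Lemma cexpNr a : cexp a * cexp (- a) = 1.
Proof. by rewrite -cexpD subrr cexp0. Qed.

Lemma nm_cexp a : nm (cexp a) = expR (complex.Re a).
Proof.
rewrite /= !exprMn -mulrDr cos2Dsin2 mulr1 sqrtr_sqr ger0_norm//.
Qed.

Lemma cexp_neq0 a : cexp a != 0.
Proof. by rewrite -nm_gt0 nm_cexp expR_gt0. Qed.

Lemma abs_sin_le x : `|sin x| <= `|x|.
Proof.
wlog x0 : x / 0 <= x => [hw|].
  have [/hw //|x0] := leP 0 x.
  by rewrite -(normrN x) -(normrN (sin x)) -sinN hw// oppr_ge0 ltW.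
have [|c _] := @MVT_segment R sin cos 0 x x0 (fun z _ => is_derive_sin z).
  by apply: continuous_subspaceT => z; exact: continuous_sin.
rewrite sin0 !subr0 => ->; rewrite normrM ler_piMl//.
exact: cos_max.
Qed.

(** By the half-angle formula [1 - cos x = 2 sin(x/2)^2], this follows from [abs_sin_le]. *)
Lemma one_subcos_le x : 1 - cos x <= x ^+ 2 / 2.
Proof.
have -> : cos x = 1 - 2 * sin (x / 2) ^+ 2.
  rewrite {1}(splitr x) cosD -!expr2 cos2sin2; ring.
rewrite opprB addrC subrK.
have : sin (x / 2) ^+ 2 <= (x / 2) ^+ 2.
  rewrite -(real_normK (num_real (sin _))) -(real_normK (num_real (x / 2))).
  by rewrite ler_sqr ?nnegrE// abs_sin_le.
rewrite exprMn; lra.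
Qed.

(** The mean value theorem for [sin t - t] gives a cubic bound, weakened to a quadratic one with
    [|x| <= 1]. *)
Lemma abs_sin_sub_le x : `|x| <= 1 -> `|sin x - x| <= x ^+ 2 / 2.
Proof.
wlog x0 : x / 0 <= x => [hw|].
  have [/hw //|x0] := leP 0 x; move=> hx.
  have := hw (- x); rewrite oppr_ge0 normrN sqrrN sinN -opprD normrN; apply => //.
  exact: ltW.
rewrite ger0_norm// => x1.
have h (z : R) : is_derive z 1 (fun t : R => sin t - t) (cos z - 1).
  exact: is_deriveB.
have [|c] := @MVT_segment R (fun t => sin t - t) (fun z => cos z - 1) 0 x x0 (fun z _ => h z).
  apply: continuous_subspaceT => z; apply: cvgB; last exact: cvg_id.
  exact: continuous_sin.
rewrite sin0 !subr0 in_itv/= => /andP[c0 cx] ->; rewrite normrM (ger0_norm x0).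
rewrite -normrN opprB ger0_norm ?subr_ge0 ?cos_le1//.
have := one_subcos_le c; have := cos_le1 c => c1 c2.
have : (1 - cos c) * x <= (c ^+ 2 / 2) * x by apply: ler_wpM2r.
have : c ^+ 2 <= x ^+ 2 by rewrite ler_sqr ?nnegrE.
have : x ^+ 2 * x <= x ^+ 2 by rewrite ler_piMr// sqr_ge0.
nra.
Qed.

(** From [1 - x <= exp(-x)] one gets [exp x <= 1/(1 - x)], and [(1 - x)(1 + x + 2 x^2) = 1 + x^2 (1
    - 2 x)] is at least 1 for [x <= 1/2]. *)
Lemma expR_sub1_le x : `|x| <= 2^-1 -> expR x - 1 - x <= 2 * x ^+ 2.
Proof.
move=> hx; have {hx} : x <= 2^-1 by exact: le_trans (ler_norm _) hx.
move=> hx; have h1 : 0 < 1 - x by lra.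
have : expR x <= (1 - x)^-1.
  rewrite -(invrK (expR x)) lef_pV2 ?posrE ?invr_gt0 ?expR_gt0//.
  by rewrite -expRN; exact: expR_ge1Dx.
suff : (1 - x)^-1 <= 1 + x + 2 * x ^+ 2 by lra.
rewrite -[leLHS]mul1r ler_pdivrMr//.
have : 0 <= x ^+ 2 * (1 - 2 * x) by rewrite mulr_ge0 ?sqr_ge0//; lra.
lra.
Qed.

(** Real and imaginary parts are compared with their Taylor polynomials separately; the two bounds
    add up to [3 (x^2 + y^2)], so 5 leaves room. *)
Lemma cexp_sub1_le a : nm a <= 2^-1 -> nm (cexp a - 1 - a) <= 5 * nm a ^+ 2.
Proof.
move=> ha; apply: le_trans (nm_le_ReIm _) _; rewrite nm_sqr.
have := le_trans (nm_Re a) ha; have := le_trans (nm_Im a) ha.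
case: a {ha} => x y /= hy hx.
have ex := expR_sub1_le hx; have ex1 := expR_ge1Dx x.
have cy := one_subcos_le y; have cy1 := cos_le1 y.
have hy1 : `|y| <= 1 by apply: le_trans hy _; lra.
have := abs_sin_sub_le hy1 => sy.
have := ler_norm x => nx.
have xx : x ^+ 2 = `|x| ^+ 2 by rewrite real_normK ?num_real.
have yy : y ^+ 2 = `|y| ^+ 2 by rewrite real_normK ?num_real.
have := normr_ge0 x; have := normr_ge0 y => y0 x0.
have e2 : expR x <= 2 by nra.
have e0 := expR_ge0 x.
have h1 : `|expR x * cos y - 1 - x| <= 2 * x ^+ 2 + y ^+ 2.
  have -> : expR x * cos y - 1 - x = (expR x - 1 - x) - expR x * (1 - cos y) by ring.
  apply: le_trans (ler_normB _ _) _; rewrite ger0_norm; last by lra.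
  rewrite normrM (ger0_norm e0) ger0_norm; last by lra.
  apply: lerD => //.
  have : expR x * (1 - cos y) <= 2 * (y ^+ 2 / 2) by apply: ler_pM => //; lra.
  lra.
have h2 : `|expR x * sin y - 0 - y| <= x ^+ 2 + 2 * y ^+ 2.
  have -> : expR x * sin y - 0 - y = expR x * (sin y - y) + (expR x - 1) * y by ring.
  apply: le_trans (ler_normD _ _) _; rewrite !normrM (ger0_norm e0).
  have : expR x * `|sin y - y| <= 2 * (y ^+ 2 / 2) by apply: ler_pM.
  have : `|expR x - 1| <= 2 * `|x|.
    apply: (@le_trans _ _ (`|expR x - 1 - x| + `|x|)).
      by rewrite -{1}(subrK x (expR x - 1)) ler_normD.
    by rewrite ger0_norm; [nra|lra].
  move=> h; have : `|expR x - 1| * `|y| <= 2 * `|x| * `|y| by apply: ler_wpM2r.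
  (* The mixed term [2 |x| |y|] is absorbed by [x^2 + y^2]. *)
  have := sqr_ge0 (`|x| - `|y|).
  nra.
have := sqr_ge0 x; have := sqr_ge0 y; lra.
Qed.

End ComplexExp.

(** * Contractions on a polydisc *)

Section Contraction.
Context {R : realType}.
Implicit Types (x y : R[i] * R[i] * R[i]).

(** This is how inequalities pass to the limit of the iteration below: the error term is
    geometric. *)
Lemma le_of_le_geo (a b K : R) : (forall n : nat, a <= b + K * 2^-1 ^+ n) -> a <= b.
Proof.
move=> h; rewrite leNgt; apply/negP => ba.
have cv : (fun n : nat => K * 2^-1 ^+ n) @ \oo --> (0 : R).
  rewrite -(mulr0 K); apply: cvgMl_tmp.
  by apply: cvg_expr; rewrite ger0_norm ?invr_ge0// invf_lt1// ltr1n.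
have /cvgrPdist_lt/(_ (a - b)) := cv.
rewrite subr_gt0 => /(_ ba) [N _ /(_ N (leqnn N))] /=.
rewrite sub0r normrN => hN; have := h N; have := ler_norm (K * 2^-1 ^+ N); lra.
Qed.

(** Nested intervals: [u n - 2 M 2^-n] increases and [u n + 2 M 2^-n] decreases, because one step of
    size [M 2^-n] is exactly what the margin loses. The limit is the supremum of the lower ends. *)
Lemma geometric_limit (u : nat -> R) (M : R) :
  (forall n, `|u n.+1 - u n| <= M * 2^-1 ^+ n) ->
  exists l, forall n, `|u n - l| <= 2 * M * 2^-1 ^+ n.
Proof.
move=> hu.
pose v n := u n - 2 * M * 2^-1 ^+ n; pose w n := u n + 2 * M * 2^-1 ^+ n.
have M0 : 0 <= M by have := hu 0%N; rewrite expr0 mulr1; apply: le_trans.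
have vS n : v n <= v n.+1.
  rewrite /v exprS; have := hu n; rewrite ler_norml => /andP[+ _]; lra.
have wS n : w n.+1 <= w n.
  rewrite /w exprS; have := hu n; rewrite ler_norml => /andP[_ +]; lra.
have vm m n : (m <= n)%N -> v m <= v n.
  by move=> /subnKC <-; elim: (n - m)%N => [|k ih]; rewrite ?addn0// addnS (le_trans ih).
have wm m n : (m <= n)%N -> w n <= w m.
  move=> /subnKC <-; elim: (n - m)%N => [|k ih]; rewrite ?addn0// addnS.
  exact: le_trans (wS _) ih.
have vw n : v n <= w n.
  rewrite /v /w; have : 0 <= 2 * M * 2^-1 ^+ n by rewrite !mulr_ge0// exprn_ge0.
  lra.
have vwmn m n : v m <= w n.
  have [mn|/ltnW nm_] := leqP m n; first exact: le_trans (vm _ _ mn) (vw n).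
  exact: le_trans (vw m) (wm _ _ nm_).
have hs : has_sup (range v).
  by split; [exists (v 0%N); exists 0%N|exists (w 0%N) => _ [m _ <-]].
exists (sup (range v)) => n.
have h1 : v n <= sup (range v) by apply: ub_le_sup; [exact: hs.2|exists n].
have h2 : sup (range v) <= w n.
  by apply: ge_sup; [exact: hs.1|move=> _ [m _ <-]].
by rewrite ler_norml; move: h1 h2; rewrite /v /w => h1 h2; apply/andP; split; lra.
Qed.

Lemma geometric_limit_complex (u : nat -> R[i]) (M : R) :
  (forall n, nm (u n.+1 - u n) <= M * 2^-1 ^+ n) ->
  exists l, forall n, nm (u n - l) <= 4 * M * 2^-1 ^+ n.
Proof.
move=> hu.
have ReB a b : complex.Re (a - b) = complex.Re a - complex.Re b :> R.
  by case: a => ? ?; case: b.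
have ImB a b : complex.Im (a - b) = complex.Im a - complex.Im b :> R.
  by case: a => ? ?; case: b.
have [n|x hx] := @geometric_limit (fun n => complex.Re (u n)) M.
  by apply: le_trans (hu n); rewrite -ReB; exact: nm_Re.
have [n|y hy] := @geometric_limit (fun n => complex.Im (u n)) M.
  by apply: le_trans (hu n); rewrite -ImB; exact: nm_Im.
exists (x +i* y)%C => n; apply: le_trans (nm_le_ReIm _) _.
rewrite ReB ImB /=; have := hx n; have := hy n; lra.
Qed.

Definition dist3 x y : R :=
  nm (x.1.1 - y.1.1) + nm (x.1.2 - y.1.2) + nm (x.2 - y.2).

Definition polydisc (r1 r2 r3 : R) x : Prop :=
  [/\ nm x.1.1 <= r1, nm x.1.2 <= r2 & nm x.2 <= r3].

(** Banach's iteration from the centre. The ratio 1/2 makes the steps geometric, so each coordinate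
    converges, and the closed bounds defining the polydisc survive in the limit. *)
Lemma polydisc_fixed_point (r1 r2 r3 : R) (F : R[i] * R[i] * R[i] -> R[i] * R[i] * R[i]) :
  0 <= r1 -> 0 <= r2 -> 0 <= r3 ->
  (forall x, polydisc r1 r2 r3 x -> polydisc r1 r2 r3 (F x)) ->
  (forall x y, polydisc r1 r2 r3 x -> polydisc r1 r2 r3 y ->
     dist3 (F x) (F y) <= 2^-1 * dist3 x y) ->
  exists2 x, polydisc r1 r2 r3 x & F x = x.
Proof.
move=> r10 r20 r30 FD Flip.
pose u n := iter n F (0, 0, 0).
have uD n : polydisc r1 r2 r3 (u n).
  have n0 r : 0 <= r -> nm (0 : R[i]) <= r by rewrite Normc.normc0.
  by elim: n => [|n ih]; [split; exact: n0|exact: FD].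
pose M := dist3 (u 1%N) (u 0%N).
have hM n : dist3 (u n.+1) (u n) <= M * 2^-1 ^+ n.
  elim: n => [|n ih]; first by rewrite expr0 mulr1.
  apply: (le_trans (Flip _ _ (uD n.+1) (uD n))).
  by rewrite exprS mulrCA ler_pM2l ?invr_gt0.
have [n|l1 h1] := @geometric_limit_complex (fun n => (u n).1.1) M.
  apply: le_trans (hM n); rewrite /dist3.
  by have := nm_ge0 ((u n.+1).1.2 - (u n).1.2); have := nm_ge0 ((u n.+1).2 - (u n).2); lra.
have [n|l2 h2] := @geometric_limit_complex (fun n => (u n).1.2) M.
  apply: le_trans (hM n); rewrite /dist3.
  by have := nm_ge0 ((u n.+1).1.1 - (u n).1.1); have := nm_ge0 ((u n.+1).2 - (u n).2); lra.
have [n|l3 h3] := @geometric_limit_complex (fun n => (u n).2) M.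
  apply: le_trans (hM n); rewrite /dist3.
  by have := nm_ge0 ((u n.+1).1.1 - (u n).1.1); have := nm_ge0 ((u n.+1).1.2 - (u n).1.2); lra.
pose l := (l1, l2, l3).
have lim_le r (v : nat -> R[i]) c : (forall n, nm (v n - c) <= 4 * M * 2^-1 ^+ n) ->
    (forall n, nm (v n) <= r) -> nm c <= r.
  move=> hv hr; apply: (@le_of_le_geo _ _ (4 * M)) => n.
  have -> : c = v n - (v n - c) by ring.
  by apply: le_trans (nmB _ _) _; apply: lerD.
have lD : polydisc r1 r2 r3 l.
  split; [apply: lim_le h1 _|apply: lim_le h2 _|apply: lim_le h3 _] => n;
    by have [] := uD n.
exists l => //.
(* 12 is three coordinates times the 4 of [geometric_limit_complex]. *)
have hl n : dist3 (u n) l <= 12 * M * 2^-1 ^+ n.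
  by rewrite /dist3; have := h1 n; have := h2 n; have := h3 n; rewrite /=; lra.
have tri a b c : dist3 a c <= dist3 b a + dist3 b c.
  rewrite /dist3.
  have t (p q r : R[i]) : nm (p - r) <= nm (q - p) + nm (q - r).
    rewrite (nmBC q p); have -> : p - r = (p - q) + (q - r) by ring.
    exact: nmD.
  have := t a.1.1 b.1.1 c.1.1; have := t a.1.2 b.1.2 c.1.2.
  have := t a.2 b.2 c.2; lra.
(* Both [F l] and [l] are close to [u n.+1]: the first by contraction from [u n], the second by
   convergence, each within [6 M 2^-n]. *)
have : dist3 (F l) l <= 0.
  apply: (@le_of_le_geo _ _ (12 * M)) => n; rewrite add0r.
  apply: le_trans (tri _ (u n.+1) _) _.
  have := Flip _ _ (uD n) lD; have := hl n; have := hl n.+1; rewrite exprS.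
  rewrite -[F (u n)]/(u n.+1); lra.
rewrite /dist3 => h.
have z (a b : R[i]) : nm (a - b) <= 0 -> a = b.
  move=> ab; apply/eqP; rewrite -subr_eq0; apply/eqP/Normc.eq0_normc/eqP.
  by rewrite eq_le ab nm_ge0.
move: (nm_ge0 ((F l).1.1 - l.1.1)) (nm_ge0 ((F l).1.2 - l.1.2)) (nm_ge0 ((F l).2 - l.2)) => p1 p2 p3.
have e1 : (F l).1.1 = l1 by apply: z; rewrite -[l1]/(l.1.1); lra.
have e2 : (F l).1.2 = l2 by apply: z; rewrite -[l2]/(l.1.2); lra.
have e3 : (F l).2 = l3 by apply: z; rewrite -[l3]/(l.2); lra.
by move: e1 e2 e3; case: (F l) => [[a b] c] /= -> -> ->.
Qed.

End Contraction.

(** * Algebra of functions that are uniformly small and Lipschitz in a parameter *)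

Section BigLip.
Context {R : realType}.
Implicit Types (f g : R -> R[i] * R[i] * R[i] -> R[i]) (i j : nat) (e : R).

(* Both the size and the Lipschitz constant of [f e] on the polydisc are [O(e ^+ j)]. *)
Definition bigO_lip (e0 : R) j f : Prop := exists2 K : R, 0 <= K &
  forall e, 0 < e <= e0 -> forall x y, polydisc e 1 1 x -> polydisc e 1 1 y ->
    nm (f e x) <= K * e ^+ j /\ nm (f e x - f e y) <= K * e ^+ j * dist3 x y.

Lemma dist3_ge0 (x y : R[i] * R[i] * R[i]) : 0 <= dist3 x y.
Proof. by rewrite /dist3 !addr_ge0// nm_ge0. Qed.

Variable e0 : R.
Hypothesis e01 : e0 <= 1.
Local Notation big := (bigO_lip e0).

Lemma bigO_lip_scale j (c : R[i]) : big j (fun e _ => (e ^+ j)%:C%C * c).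
Proof.
exists (nm c) => [|e /andP[e1 _] x y _ _]; first exact: nm_ge0.
have ej : 0 <= e ^+ j by rewrite exprn_ge0// ltW.
rewrite nmM nm_real ger0_norm// mulrC subrr Normc.normc0; split => //.
by rewrite !mulr_ge0 ?nm_ge0 ?dist3_ge0.
Qed.

Lemma bigO_lip_cst (c : R[i]) : big 0 (fun _ _ => c).
Proof.
have [K K0 h] := bigO_lip_scale 0 c; exists K => // e he x y hx hy.
by have := h e he x y hx hy; rewrite expr0 mul1r.
Qed.

Lemma bigO_lip1 : big 0 (fun _ x => x.1.1).
Proof.
exists 1 => // e /andP[e1 e2] x y [h1 _ _] _; rewrite expr0 !mul1r; split.
  by apply: le_trans h1 _; exact: le_trans e01.
by rewrite /dist3 -addrA lerDl addr_ge0 ?nm_ge0.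
Qed.

Lemma bigO_lip2 : big 0 (fun _ x => x.1.2).
Proof.
exists 1 => // e _ x y [_ h2 _] _; rewrite expr0 !mul1r; split => //.
by rewrite /dist3 addrAC lerDr addr_ge0 ?nm_ge0.
Qed.

Lemma bigO_lip3 : big 0 (fun _ x => x.2).
Proof.
exists 1 => // e _ x y [_ _ h3] _; rewrite expr0 !mul1r; split => //.
by rewrite /dist3 lerDr addr_ge0 ?nm_ge0.
Qed.

Lemma bigO_lipD j f g : big j f -> big j g -> big j (fun e x => f e x + g e x).
Proof.
move=> [K K0 hf] [K' K'0 hg]; exists (K + K') => [|e he x y hx hy].
  exact: addr_ge0.
have [f1 f2] := hf e he x y hx hy; have [g1 g2] := hg e he x y hx hy.
split; first by apply: le_trans (nmD _ _) _; rewrite mulrDl lerD.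
have -> : f e x + g e x - (f e y + g e y) = (f e x - f e y) + (g e x - g e y) by ring.
by apply: le_trans (nmD _ _) _; rewrite !mulrDl lerD.
Qed.

Lemma bigO_lipN j f : big j f -> big j (fun e x => - f e x).
Proof.
move=> [K K0 hf]; exists K => // e he x y hx hy.
by have [f1 f2] := hf e he x y hx hy; rewrite -opprD !nmN.
Qed.

(** Orders add up, so an explicit prefactor [e ^+ j] makes a bounded Lipschitz expression small
    together with its Lipschitz constant. *)
Lemma bigO_lipM i j f g : big i f -> big j g -> big (i + j) (fun e x => f e x * g e x).
Proof.
move=> [K K0 hf] [K' K'0 hg]; exists (2 * (K * K')) => [|e he x y hx hy].
  by rewrite !mulr_ge0.
have [f1 f2] := hf e he x y hx hy; have [g1 g2] := hg e he x y hx hy.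
have [fy _] := hf e he y x hy hx.
case/andP: he => e1 _; have ei : 0 <= e ^+ i by rewrite exprn_ge0// ltW.
have ej : 0 <= e ^+ j by rewrite exprn_ge0// ltW.
have nmp := nm_ge0.
have d0 := dist3_ge0 x y.
have h : nm (f e x * g e x) <= (K * e ^+ i) * (K' * e ^+ j).
  by rewrite nmM ler_pM.
have KK : 0 <= (K * e ^+ i) * (K' * e ^+ j) by rewrite !mulr_ge0.
split; first by apply: le_trans h _; rewrite exprD; lra.
have -> : f e x * g e x - f e y * g e y =
  (f e x - f e y) * g e x + f e y * (g e x - g e y) by ring.
apply: le_trans (nmD _ _) _; rewrite !nmM.
have h1 : nm (f e x - f e y) * nm (g e x) <= (K * e ^+ i * dist3 x y) * (K' * e ^+ j).
  exact: ler_pM.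
have h2 : nm (f e y) * nm (g e x - g e y) <= (K * e ^+ i) * (K' * e ^+ j * dist3 x y).
  exact: ler_pM.
by apply: le_trans (lerD h1 h2) _; rewrite exprD le_eqVlt; apply/orP; left; apply/eqP; ring.
Qed.

Lemma bigO_lipW i j f : (i <= j)%N -> big j f -> big i f.
Proof.
move=> ij [K K0 hf]; exists K => // e he x y hx hy.
have [f1 f2] := hf e he x y hx hy; case/andP: he => e1 e2.
have eij : K * e ^+ j <= K * e ^+ i.
  apply: ler_wpM2l => //; apply: ler_wiXn2l => //; first exact: ltW.
  exact: le_trans e01.
split; first exact: le_trans eij.
by apply: le_trans f2 _; rewrite ler_wpM2r// dist3_ge0.
Qed.

(** [1/a - 1/b = -(a - b)/(a b)] costs a factor [m^-2]; the sum [m^-1 + K m^-2] serves both the size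
    and the Lipschitz constant. *)
Lemma bigO_lipV f (m : R) : 0 < m ->
  (forall e, 0 < e <= e0 -> forall x, polydisc e 1 1 x -> m <= nm (f e x)) ->
  big 0 f -> big 0 (fun e x => (f e x)^-1).
Proof.
move=> m0 hm [K K0 hf]; exists (m^-1 + K * (m^-1 * m^-1)) => [|e he x y hx hy].
  by rewrite !(addr_ge0, mulr_ge0)// invr_ge0 ltW.
have mV0 : 0 <= m^-1 by rewrite invr_ge0 ltW.
have [f1 f2] := hf e he x y hx hy; have mx := hm e he x hx; have my := hm e he y hy.
have fx0 : f e x != 0 by rewrite -nm_gt0 (lt_le_trans m0).
have fy0 : f e y != 0 by rewrite -nm_gt0 (lt_le_trans m0).
have vx : (nm (f e x))^-1 <= m^-1 by rewrite lef_pV2 ?posrE// (lt_le_trans m0).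
have vy : (nm (f e y))^-1 <= m^-1 by rewrite lef_pV2 ?posrE// (lt_le_trans m0).
rewrite expr0 !mulr1 in f1 f2 *; rewrite nmV; split.
  by apply: le_trans vx _; rewrite lerDl !mulr_ge0.
have -> : (f e x)^-1 - (f e y)^-1 = - (f e x - f e y) * ((f e x)^-1 * (f e y)^-1).
  by field; rewrite fx0 fy0.
have d0 := dist3_ge0 x y.
rewrite !nmM nmN !nmV mulrDl; apply: (@le_trans _ _ (K * dist3 x y * (m^-1 * m^-1))).
  by apply: ler_pM; rewrite ?nm_ge0 ?mulr_ge0 ?invr_ge0 ?nm_ge0//; apply: ler_pM; rewrite ?invr_ge0 ?nm_ge0.
by rewrite [leRHS]addrC mulrAC lerDl mulr_ge0.
Qed.

End BigLip.

(** * Lipschitz bounds for the exponential and the sine *)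

Section CexpLip.
Context {R : realType}.
Implicit Types (a b : R[i]).

Lemma cexp_sub1_lip a : nm a <= 2^-1 -> nm (cexp a - 1) <= 4 * nm a.
Proof.
move=> ha; have := cexp_sub1_le ha; have := nmD (cexp a - 1 - a) a.
by rewrite subrK; have := nm_ge0 a; nra.
Qed.

(** For [a] near [b], [exp b] factors out and the linear bound applies; otherwise [nm (a - b) > 1/2]
    and the trivial bound [2 exp M] suffices. The constant decays with [M], which is what makes [E]
    small in the Lipschitz sense too. *)
Lemma cexp_lip (M : R) a b : complex.Re a <= M -> complex.Re b <= M ->
  nm (cexp a - cexp b) <= 4 * expR M * nm (a - b).
Proof.
move=> aM bM; have ea : expR (complex.Re a) <= expR M by rewrite ler_expR.
have eb : expR (complex.Re b) <= expR M by rewrite ler_expR.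
have := expR_gt0 M; have := expR_gt0 (complex.Re b) => b0 M0.
have [h|h] := leP (nm (a - b)) 2^-1.
  have -> : cexp a - cexp b = cexp b * (cexp (a - b) - 1).
    by rewrite mulrBr mulr1 -cexpD [b + _]addrC subrK.
  rewrite nmM nm_cexp [leRHS]mulrAC [leRHS]mulrC.
  by apply: ler_pM => //; [exact: nm_ge0|exact: cexp_sub1_lip].
apply: le_trans (nmB _ _) _; rewrite !nm_cexp; nra.
Qed.

Definition ccos a : R[i] := (cexp ('i%C * a) + cexp (- ('i%C * a))) / 2.
Definition csin a : R[i] := (cexp ('i%C * a) - cexp (- ('i%C * a))) / (2 * 'i%C).

(** The map [exp w - w] has vanishing derivative at 0, hence a Lipschitz constant [O(m)] on the disc
    of radius [m]. The quadratic remainder contributes [20 m] and the factor [exp b - 1] contributes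
    [4 m]. *)
Lemma cexp_sub_id_lip (m : R) a b : m <= 4^-1 -> nm a <= m -> nm b <= m ->
  nm (cexp a - cexp b - (a - b)) <= 28 * m * nm (a - b).
Proof.
move=> m4 am bm.
have ab : nm (a - b) <= 2 * m by apply: le_trans (nmB _ _) _; lra.
have ab2 : nm (a - b) <= 2^-1 by lra.
have -> : cexp a - cexp b - (a - b) =
    cexp b * (cexp (a - b) - 1 - (a - b)) + (cexp b - 1) * (a - b).
  by rewrite -{1}(subrK b a) (cexpD (a - b) b); ring.
apply: le_trans (nmD _ _) _; rewrite !nmM.
have h1 := cexp_sub1_le ab2.
have b2 : nm b <= 2^-1 by lra.
have h2 := cexp_sub1_lip b2.
have h3 : nm (cexp b) <= 2.
  by have := nmD (cexp b - 1) 1; rewrite subrK Normc.normc1; lra.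
have p1 := nm_ge0 (cexp b); have p2 := nm_ge0 (a - b).
have p3 := nm_ge0 (cexp (a - b) - 1 - (a - b)); have p4 := nm_ge0 (cexp b - 1).
have q1 : nm (cexp b) * nm (cexp (a - b) - 1 - (a - b)) <= 2 * (5 * nm (a - b) ^+ 2).
  exact: ler_pM.
have q2 : nm (cexp b - 1) * nm (a - b) <= (4 * m) * nm (a - b).
  by apply: ler_wpM2r => //; lra.
have q3 : nm (a - b) * nm (a - b) <= (2 * m) * nm (a - b) by apply: ler_wpM2r.
by rewrite expr2 in q1; lra.
Qed.

Lemma nm_i : nm ('i%C : R[i]) = 1.
Proof. by rewrite /= expr0n expr1n add0r sqrtr1. Qed.

Lemma ci_neq0 : ('i%C : R[i]) != 0.
Proof. by rewrite -nm_gt0 nm_i. Qed.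

(** The two exponentials in [csin] each contribute the previous bound, and the prefactor of modulus
    1/2 restores the constant. *)
Lemma csin_sub_id_lip (m : R) a b : m <= 4^-1 -> nm a <= m -> nm b <= m ->
  nm (csin a - csin b - (a - b)) <= 28 * m * nm (a - b).
Proof.
move=> m4 am bm; have i0 := ci_neq0.
have -> : csin a - csin b - (a - b) =
   (2 * 'i%C)^-1 * ((cexp ('i%C * a) - cexp ('i%C * b) - ('i%C * a - 'i%C * b))
    - (cexp (- ('i%C * a)) - cexp (- ('i%C * b)) - (- ('i%C * a) - - ('i%C * b)))).
  by rewrite /csin; field.
have mi c : nm ('i%C * c : R[i]) = nm c by rewrite nmM nm_i mul1r.
have h1 := @cexp_sub_id_lip m ('i%C * a) ('i%C * b) m4.
have h2 := @cexp_sub_id_lip m (- ('i%C * a)) (- ('i%C * b)) m4.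
rewrite -opprD nmN -mulrBr !nmN !mi in h1 h2.
rewrite nmM nmV nmM nm_i mulr1.
have -> : nm (2 : R[i]) = 2.
  by rewrite -[2%:R](rmorph_nat (real_complex R)) nm_real ger0_norm.
rewrite ler_pdivrMl//; apply: le_trans (nmB _ _) _.
rewrite -opprD -!mulrBr; have := h1 am bm; have := h2 am bm; lra.
Qed.

End CexpLip.

(** * The root of the characteristic system *)

(* [e] stands for [N^(-1/4)].  The components of [x] are the deviations of [k],
   [z] and [kappa] from [k0], [i N] and [beta (1 + i) / e^2], and
   [(F1a + F1b, F2, F3)] is the contraction; the powers of [e] are pulled out of
   the denominators so that each component is [O(e)].  The factors [1] match the
   shape of [bigO_lip_scale]. *)
Section ResonantPoint.
Context {R : realType}.
Variables (s L beta B k0 : R).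
Hypotheses (s0 : 0 < s) (s1 : s <= 1) (L0 : 0 < L) (beta0 : 0 < beta)
  (betaB : 2 * beta ^+ 2 = B).
Implicit Types (e : R) (x y : R[i] * R[i] * R[i]).

(** The bound 1/4 puts the argument of the sine in the range of [csin_sub_id_lip]; [beta / 2] keeps
    [den1] and [den3] away from 0. *)
Let e0 : R := Num.min 4^-1 (beta / 2).

Let e0_gt0 : 0 < e0.
Proof. by rewrite /e0 lt_min divr_gt0// invr_gt0 ltr0n. Qed.

Let e0_le4 : e0 <= 4^-1.
Proof. by rewrite /e0 ge_min lexx. Qed.

Let e0_le1 : e0 <= 1.
Proof. by apply: le_trans e0_le4 _; lra. Qed.

Let e0_beta : e0 <= beta / 2.
Proof. by rewrite /e0 ge_min lexx orbT. Qed.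

Let waveno x : R[i] := k0%:C%C + x.1.1.
Let kap e x : R[i] := (beta / e ^+ 2)%:C%C * (1 + 'i%C) + x.2.
(** This is [E], through which [tanh(L kappa) = (1 - E) / (1 + E)]. *)
Let expo e x : R[i] := cexp (- ((2 * L)%:C%C * kap e x)).
(** With [kappa0] the leading part of [kappa] and [N = e^-4], the three denominators are
    [e^2 kappa], [e^4 (2 i N + x.1.2)] and [e^2 (2 kappa0 + x.2)]. The last two are the large
    factors of [z^2 - (i N)^2] and [kappa^2 - kappa0^2]. *)
Let den1 e x : R[i] := beta%:C%C * (1 + 'i%C) + (e ^+ 2)%:C%C * 1 * x.2.
Let den2 e x : R[i] := 2 * 'i%C + (e ^+ 4)%:C%C * 1 * x.1.2.
Let den3 e x : R[i] := (2 * beta)%:C%C * (1 + 'i%C) + (e ^+ 2)%:C%C * 1 * x.2.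

Let nm_beta1i (c : R) : 0 <= c -> c <= nm (c%:C%C * (1 + 'i%C)).
Proof.
move=> c0; apply: le_trans (nm_Re _); rewrite cReM /=.
by rewrite !mul0r subr0 addr0 mulr1; exact: ler_norm.
Qed.

Let e_bounds e : 0 < e <= e0 -> [/\ 0 < e, e <= 4^-1, e <= 1, e ^+ 2 <= e & e ^+ 4 <= e].
Proof.
move=> /andP[e1 e2]; have e4 : e <= 4^-1 by exact: le_trans e0_le4.
have e3 : e <= 1 by lra.
split => //; rewrite exprS ler_piMr ?(ltW e1)// exprn_ile1//; exact: ltW.
Qed.

Let nm_scale e j (a : R[i]) : 0 < e -> nm ((e ^+ j)%:C%C * 1 * a) = e ^+ j * nm a.
Proof. by move=> e1; rewrite mulr1 nmM nm_real ger0_norm// exprn_ge0// ltW. Qed.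

Let den1_ge e : 0 < e <= e0 -> forall x, polydisc e 1 1 x -> beta / 2 <= nm (den1 e x).
Proof.
move=> he x [_ _ h3]; have [e1 _ _ e2 _] := e_bounds he; case/andP: he => _ /le_trans/(_ e0_beta) ee0.
apply: le_trans (nm_subadd _ _); rewrite nm_scale//.
have := nm_beta1i (ltW beta0).
have : e ^+ 2 * nm x.2 <= e ^+ 2 * 1 by rewrite ler_wpM2l// exprn_ge0// ltW.
lra.
Qed.

Let den2_ge e : 0 < e <= e0 -> forall x, polydisc e 1 1 x -> 1 <= nm (den2 e x).
Proof.
move=> he x [_ h2 _]; have [e1 e4 _ _ e2] := e_bounds he.
apply: le_trans (nm_subadd _ _); rewrite nm_scale// nmM nm_i mulr1.
have -> : nm (2 : R[i]) = 2.
  by rewrite -[2%:R](rmorph_nat (real_complex R)) nm_real ger0_norm.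
have : e ^+ 4 * nm x.1.2 <= e ^+ 4 * 1 by rewrite ler_wpM2l// exprn_ge0// ltW.
lra.
Qed.

Let den3_ge e : 0 < e <= e0 -> forall x, polydisc e 1 1 x -> beta <= nm (den3 e x).
Proof.
move=> he x [_ _ h3]; have [e1 _ _ e2 _] := e_bounds he; case/andP: he => _ /le_trans/(_ e0_beta) ee0.
apply: le_trans (nm_subadd _ _); rewrite nm_scale//.
have : 0 <= 2 * beta by lra.
move/nm_beta1i.
have : e ^+ 2 * nm x.2 <= e ^+ 2 * 1 by rewrite ler_wpM2l// exprn_ge0// ltW.
lra.
Qed.

Local Notation big := (bigO_lip e0).

Let big_waveno : big 0 (fun _ x => waveno x).
Proof. apply: bigO_lipD; [exact: bigO_lip_cst|exact: bigO_lip1]. Qed.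

Let big_den1V : big 0 (fun e x => (den1 e x)^-1).
Proof.
apply: bigO_lipV den1_ge _; first by rewrite divr_gt0.
apply: bigO_lipD; first exact: bigO_lip_cst.
apply: (@bigO_lipW _ _ e0_le1 0 (2 + 0)) => //.
by apply: bigO_lipM; [exact: bigO_lip_scale|exact: bigO_lip3].
Qed.

Let big_den2V : big 0 (fun e x => (den2 e x)^-1).
Proof.
apply: bigO_lipV den2_ge _; first by [].
apply: bigO_lipD; first exact: bigO_lip_cst.
apply: (@bigO_lipW _ _ e0_le1 0 (4 + 0)) => //.
by apply: bigO_lipM; [exact: bigO_lip_scale|exact: bigO_lip2].
Qed.

Let big_den3V : big 0 (fun e x => (den3 e x)^-1).
Proof.
apply: bigO_lipV den3_ge _; first by [].
apply: bigO_lipD; first exact: bigO_lip_cst.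
apply: (@bigO_lipW _ _ e0_le1 0 (2 + 0)) => //.
by apply: bigO_lipM; [exact: bigO_lip_scale|exact: bigO_lip3].
Qed.

Let big_cexp (c : R[i]) : big 0 (fun _ x => cexp (c * x.1.1)).
Proof.
have bound (x : R[i] * R[i] * R[i]) e : 0 < e <= e0 -> polydisc e 1 1 x ->
    complex.Re (c * x.1.1) <= nm c.
  move=> he [h1 _ _]; have [e1 _ ee _ _] := e_bounds he.
  apply: le_trans (ler_norm _) _; apply: le_trans (nm_Re _) _.
  by rewrite nmM ler_piMr ?nm_ge0// (le_trans h1).
have c0 := nm_ge0 c; have ec := expR_gt0 (nm c).
exists (expR (nm c) + 4 * expR (nm c) * nm c) => [|e he x y hx hy].
  by rewrite addr_ge0// ?mulr_ge0// ?ltW.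
rewrite expr0 mulr1 nm_cexp; split.
  apply: (@le_trans _ _ (expR (nm c))).
    by rewrite ler_expR; exact: bound he hx.
  by rewrite lerDl !mulr_ge0// ltW.
apply: le_trans (cexp_lip (bound _ _ he hx) (bound _ _ he hy)) _.
rewrite -mulrBr nmM mulrA [leRHS]mulrDl -[leLHS]add0r; apply: lerD.
  by rewrite mulr_ge0 ?dist3_ge0// ltW.
apply: ler_wpM2l; first by rewrite !mulr_ge0// ltW.
by rewrite /dist3 -addrA lerDl addr_ge0 ?nm_ge0.
Qed.

Let big_csin : big 0 (fun _ x => csin (s%:C%C * x.1.1)).
Proof.
rewrite /csin; apply: (@bigO_lipM _ _ 0 0); last exact: bigO_lip_cst.
apply: bigO_lipD.
  under eq_fun => e do under eq_fun => x do rewrite mulrA.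
  exact: big_cexp.
apply: bigO_lipN.
under eq_fun => e do under eq_fun => x do rewrite mulrA -mulNr.
exact: big_cexp.
Qed.

Let big_ccos : big 0 (fun _ x => ccos (s%:C%C * x.1.1)).
Proof.
rewrite /ccos; apply: (@bigO_lipM _ _ 0 0); last exact: bigO_lip_cst.
apply: bigO_lipD.
  under eq_fun => e do under eq_fun => x do rewrite mulrA.
  exact: big_cexp.
under eq_fun => e do under eq_fun => x do rewrite mulrA -mulNr.
exact: big_cexp.
Qed.

Let expo_bound e x : 0 < e <= e0 -> polydisc e 1 1 x ->
  complex.Re (- ((2 * L)%:C%C * kap e x)) <= 2 * L - 2 * L * (beta / e ^+ 2).
Proof.
move=> he [_ _ h3].
have -> : complex.Re (- ((2 * L)%:C%C * kap e x)) =
    - (2 * L * (beta / e ^+ 2 + complex.Re x.2)).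
  by rewrite /kap -mulrN cReM /= mul0r subr0; case: x.2 => a b /=; ring.
have : - 1 <= complex.Re x.2.
  by have := le_trans (nm_Re x.2) h3; rewrite ler_norml => /andP[].
move=> h; have : 2 * L * (- 1) <= 2 * L * complex.Re x.2 by rewrite ler_pM2l ?mulr_gt0//.
lra.
Qed.

(** The exponential decay is traded for a power through [exp(-t) <= 1/t] with [t = 2 L beta / e^2];
    order 2 is what [F1b] requires. *)
Let expR_bound e : 0 < e ->
  expR (2 * L - 2 * L * (beta / e ^+ 2)) <= expR (2 * L) / (2 * L * beta) * e ^+ 2.
Proof.
move=> e1; rewrite expRD -[leRHS]mulrA; apply: ler_wpM2l; first exact: expR_ge0.
have e2 : 0 < e ^+ 2 by rewrite exprn_gt0.
have t0 : 0 < 2 * L * (beta / e ^+ 2) by rewrite !mulr_gt0// invr_gt0.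
rewrite expRN; have -> : (2 * L * beta)^-1 * e ^+ 2 = (2 * L * (beta / e ^+ 2))^-1.
  by field; rewrite !gt_eqF.
rewrite lef_pV2 ?posrE ?expR_gt0//.
by have := expR_ge1Dx (2 * L * (beta / e ^+ 2)); lra.
Qed.

(** On the polydisc [Re kappa >= beta / e^2 - 1], so [cexp_lip] gives a Lipschitz constant as small
    as the function itself. *)
Let big_expo : big 2 expo.
Proof.
pose K := expR (2 * L) / (2 * L * beta).
have K0 : 0 <= K by rewrite /K divr_ge0 ?expR_ge0// !mulr_ge0// ltW.
have LL : 0 <= 2 * L by rewrite mulr_ge0// ltW.
exists (K + 4 * K * (2 * L)) => [|e he x y hx hy].
  by apply: addr_ge0 => //; do 2!apply: mulr_ge0 => //.
have [e1 _ _ _ _] := e_bounds he.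
have ee : 0 <= e ^+ 2 by rewrite exprn_ge0// ltW.
have := expR_bound e1; rewrite -/K => hK.
split.
  rewrite /expo nm_cexp; apply: (@le_trans _ _ (K * e ^+ 2)).
    by apply: le_trans hK; rewrite ler_expR; exact: expo_bound he hx.
  by rewrite ler_wpM2r// lerDl mulr_ge0// mulr_ge0.
apply: le_trans (cexp_lip (expo_bound he hx) (expo_bound he hy)) _.
have -> : nm (- ((2 * L)%:C%C * kap e x) - - ((2 * L)%:C%C * kap e y)) =
    2 * L * nm (x.2 - y.2).
  have -> : - ((2 * L)%:C%C * kap e x) - - ((2 * L)%:C%C * kap e y) =
    - ((2 * L)%:C%C * (x.2 - y.2)) by rewrite /kap; ring.
  by rewrite nmN nmM nm_real ger0_norm.
have h : nm (x.2 - y.2) <= dist3 x y.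
  by rewrite /dist3 lerDr addr_ge0 ?nm_ge0.
have n0 := nm_ge0 (x.2 - y.2).
apply: (@le_trans _ _ (4 * (K * e ^+ 2) * (2 * L * dist3 x y))).
  apply: ler_pM; [by rewrite mulr_ge0 ?expR_ge0|by rewrite mulr_ge0| |].
    by rewrite ler_pM2l.
  exact: ler_wpM2l.
have -> : 4 * (K * e ^+ 2) * (2 * L * dist3 x y) = 4 * K * (2 * L) * e ^+ 2 * dist3 x y by ring.
rewrite ler_wpM2r ?dist3_ge0// ler_wpM2r// lerDr; exact: K0.
Qed.

(** With [k s = pi/2 + s x.1.1], the root equation reads [kappa sin(s x.1.1) (1 - E) + k cos(s
    x.1.1) (1 + E) = 0]. Solving for the sine and subtracting its linear part gives [F1a + F1b]:
    [F1a] is the nonlinear remainder of the sine, [F1b] collects the terms carrying [E] or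
    [1/kappa]. *)
Let F1a (x : R[i] * R[i] * R[i]) : R[i] := x.1.1 - s^-1%:C%C * csin (s%:C%C * x.1.1).
Let F1b e x : R[i] := s^-1%:C%C * (csin (s%:C%C * x.1.1) * expo e x
  - ((e ^+ 2)%:C%C * 1) * ((waveno x * ccos (s%:C%C * x.1.1)) * ((1 + expo e x) * (den1 e x)^-1))).
Let F2 e x : R[i] := - ((e ^+ 4)%:C%C * 1 * (waveno x * waveno x * (den2 e x)^-1)).
Let F3 e x : R[i] :=
  (e ^+ 2)%:C%C * 1 * ((B%:C%C * x.1.2 - waveno x * waveno x) * (den3 e x)^-1).

(** No power of [e] stands in front of [F1a]; its smallness comes from [|x.1.1| <= e] alone, which
    is why the first radius of the polydisc is [e]. *)
Let F1a_lip e x y : 0 < e <= e0 -> polydisc e 1 1 x -> polydisc e 1 1 y ->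
  nm (F1a x - F1a y) <= 28 * e * nm (x.1.1 - y.1.1).
Proof.
move=> he [hx _ _] [hy _ _]; have [e1 e4 _ _ _] := e_bounds he.
have sC : s%:C%C != 0 :> R[i] by rewrite eq_complex /= eqxx andbT gt_eqF.
have sb a : nm a <= e -> nm (s%:C%C * a) <= e.
  move=> ha; rewrite nmM nm_real gtr0_norm//; apply: le_trans ha.
  by rewrite ler_piMl ?nm_ge0.
have := csin_sub_id_lip e4 (sb _ hx) (sb _ hy).
set d := _ - _ - _ => hd.
have -> : F1a x - F1a y = - (s^-1%:C%C * d).
  rewrite /F1a /d; rewrite (rmorphV (real_complex R)) ?unitfE ?gt_eqF//; by field.
rewrite nmN nmM nm_real gtr0_norm ?invr_gt0// ler_pdivrMl//.
apply: le_trans hd _; rewrite -mulrBr nmM nm_real gtr0_norm//.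
by rewrite le_eqVlt; apply/orP; left; apply/eqP; ring.
Qed.

Let F1a_le e x : 0 < e <= e0 -> polydisc e 1 1 x -> nm (F1a x) <= 28 * e * nm x.1.1.
Proof.
move=> he hx; have [e1 _ _ _ _] := e_bounds he.
have h0 : polydisc e 1 1 (0 : R[i] * R[i] * R[i]).
  by split; rewrite (Normc.normc0 R)// ltW.
have F0 : F1a 0 = 0.
  by rewrite /F1a /csin !mulr0 oppr0 subrr mul0r mulr0 subr0.
by have := F1a_lip he hx h0; rewrite F0 !subr0.
Qed.

(** Order 2 is kept here, whereas [F2] and [F3] are weakened to order 1: it becomes the bound
    [K * e ^+ 2] on the correction of [k], hence the exponent 3/2 of the theorem. *)
Let big_F1b : big 2 F1b.
Proof.
apply: (@bigO_lipM _ _ 0 2); first exact: bigO_lip_cst.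
apply: bigO_lipD.
  by apply: (@bigO_lipM _ _ 0 2).
apply: bigO_lipN.
apply: (@bigO_lipM _ _ 2 0); first exact: bigO_lip_scale.
apply: (@bigO_lipM _ _ 0 0).
  by apply: (@bigO_lipM _ _ 0 0).
apply: (@bigO_lipM _ _ 0 0) => //.
apply: bigO_lipD; first exact: bigO_lip_cst.
exact: (@bigO_lipW _ _ e0_le1 0 (2)).
Qed.

Let big_F2 : big 1 F2.
Proof.
apply: (@bigO_lipW _ _ e0_le1 1 (4)) => //; apply: bigO_lipN.
apply: (@bigO_lipM _ _ 4 0); first exact: bigO_lip_scale.
apply: (@bigO_lipM _ _ 0 0) => //.
by apply: (@bigO_lipM _ _ 0 0).
Qed.

Let big_F3 : big 1 F3.
Proof.
apply: (@bigO_lipW _ _ e0_le1 1 (2)) => //.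
apply: (@bigO_lipM _ _ 2 0); first exact: bigO_lip_scale.
apply: (@bigO_lipM _ _ 0 0) => //.
apply: bigO_lipD.
  by apply: (@bigO_lipM _ _ 0 0); [exact: bigO_lip_cst|exact: bigO_lip2].
by apply: bigO_lipN; apply: (@bigO_lipM _ _ 0 0).
Qed.

(** Here [N] is any large real number; that it be a multiple of [2 pi] enters only when the mode is
    built. The constants are uniform in [e]. *)
Lemma resonant_point : exists K e1 : R, [/\ 0 <= K, 0 < e1 &
  forall e, 0 < e <= e1 -> exists th ze et : R[i],
    let N := (e ^- 4)%:C%C in let k := k0%:C%C + th in
    let z := N * 'i%C + ze in
    let ka := (beta / e ^+ 2)%:C%C * (1 + 'i%C) + et in
    let E := cexp (- ((2 * L)%:C%C * ka)) in
    [/\ nm th <= K * e ^+ 2 /\ nm th <= 1, nm ze <= 1,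
        nm E < 1,
        z ^+ 2 = - (N ^+ 2 + k ^+ 2) /\ ka ^+ 2 = B%:C%C * z - k ^+ 2 &
        ka * csin (s%:C%C * th) * (1 - E) + k * ccos (s%:C%C * th) * (1 + E) = 0]].
Proof.
have [K1 K10 h1] := big_F1b; have [K2 K20 h2] := big_F2.
have [K3 K30 h3] := big_F3; have [K4 K40 h4] := big_expo.
(* 28 is the constant of [F1a_lip]. The choice of [e1] gives [K * e <= 1/4], which covers stability
   of the polydisc, contraction, and [nm E < 1] (through [K4]). *)
pose K := K1 + K2 + K3 + K4 + 28.
have K0 : 0 < K by rewrite /K; lra.
pose e1 := Num.min e0 (4 * K)^-1.
have e10 : 0 < e1 by rewrite lt_min e0_gt0 invr_gt0 mulr_gt0.
exists (2 * K1), e1; split; [lra|exact: e10|move=> e /andP[epos ee1]].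
have he : 0 < e <= e0.
  by rewrite epos (le_trans ee1)// /e1 ge_min lexx.
have eK : K * e <= 4^-1.
  have : e <= (4 * K)^-1 by rewrite (le_trans ee1)// /e1 ge_min lexx orbT.
  move=> h; apply: le_trans (ler_wpM2l (ltW K0) h) _.
  by rewrite invfM mulrCA divff ?mulr1// gt_eqF.
have [_ e4 el1 e2e _] := e_bounds he.
have e20 : 0 <= e ^+ 2 by rewrite exprn_ge0// ltW.
have Ke c : 0 <= c -> c * e ^+ 2 <= c * e by move=> c0; rewrite ler_wpM2l.
have ce c : 0 <= c -> 0 <= c * e by move=> c0; rewrite mulr_ge0// ltW.
have sumK : K1 * e + K2 * e + K3 * e + K4 * e + 28 * e <= 4^-1.
  by apply: le_trans eK; rewrite /K !mulrDl.
have := ce _ K10; have := ce _ K20; have := ce _ K30; have := ce _ K40.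
move=> c4 c3 c2 c1.
have [|||||] := @polydisc_fixed_point R e 1 1 (fun x => (F1a x + F1b e x, F2 e x, F3 e x)).
- exact: ltW.
- by [].
- by [].
- move=> x hx; have [b1 _] := h1 e he x x hx hx; have [b2 _] := h2 e he x x hx hx.
  have [b3 _] := h3 e he x x hx hx; rewrite expr1 in b2 b3.
  split => /=; [|lra|lra].
  apply: le_trans (nmD _ _) _; have := F1a_le he hx; have [hx1 _ _] := hx.
  have : 28 * e * nm x.1.1 <= 28 * e * e by rewrite ler_wpM2l//; lra.
  have : (28 * e + K1 * e) * e <= 4^-1 * e by rewrite ler_wpM2r//; lra.
  by rewrite expr2 in b1; lra.
- move=> x y hx hy; have [_ b1] := h1 e he x y hx hy; have [_ b2] := h2 e he x y hx hy.
  have [_ b3] := h3 e he x y hx hy; rewrite expr1 in b2 b3.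
  rewrite {1}/dist3 /=.
  have -> : F1a x + F1b e x - (F1a y + F1b e y) = (F1a x - F1a y) + (F1b e x - F1b e y) by ring.
  have := nmD (F1a x - F1a y) (F1b e x - F1b e y).
  have := F1a_lip he hx hy.
  have d0 := dist3_ge0 x y.
  have : 28 * e * nm (x.1.1 - y.1.1) <= 28 * e * dist3 x y.
    rewrite ler_wpM2l//; first lra.
    by rewrite /dist3 -addrA lerDl addr_ge0 ?nm_ge0.
  have := ler_wpM2r d0 (Ke _ K10).
  have : (28 * e + K1 * e + K2 * e + K3 * e) * dist3 x y <= 4^-1 * dist3 x y.
    by rewrite ler_wpM2r//; lra.
  lra.
case=> [[th ze] et] hx [f1 f2 f3].
pose x := (th, ze, et); rewrite -/x in hx f1 f2 f3.
have [hx1 hx2 hx3] := hx.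
exists th, ze, et => N k z ka E.
have n1 (a : R) : a != 0 -> a%:C%C != 0 :> R[i].
  by move=> a0; rewrite eq_complex /= eqxx andbT.
have eC : e%:C%C != 0 :> R[i] by rewrite n1// gt_eqF.
have d1 : den1 e x != 0.
  by rewrite -nm_gt0; apply: lt_le_trans (den1_ge he hx); rewrite divr_gt0.
have d2 : den2 e x != 0.
  by rewrite -nm_gt0; apply: lt_le_trans (den2_ge he hx).
have d3 : den3 e x != 0.
  by rewrite -nm_gt0; apply: lt_le_trans (den3_ge he hx).
have NE : N = e%:C%C ^- 4.
  by rewrite /N (rmorphV (real_complex R)) ?rmorphXn// unitfE expf_neq0// gt_eqF.
have kaE : ka = beta%:C%C * (1 + 'i%C) * e%:C%C ^- 2 + et.
  rewrite /ka rmorphM (rmorphV (real_complex R)) ?rmorphXn; last first.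
    by rewrite unitfE expf_neq0// gt_eqF.
  by rewrite mulrAC.
have BC : B%:C%C = 2 * beta%:C%C ^+ 2 :> R[i].
  by rewrite -betaB rmorphM rmorphXn rmorph_nat.
have [b1 _] := h1 e he x x hx hx.
have [b4 _] := h4 e he x x hx hx.
split.
- split; last by apply: le_trans hx1 _.
  (* Bootstrap from radius [e] to order [e^2]: at the fixed point [nm th <= nm th / 4 + K1 e^2], so
     [2 * K1] is enough. *)
  have := nmD (F1a x) (F1b e x); rewrite f1 => t1.
  have t2 := F1a_le he hx; rewrite -[x.1.1]/th in t2.
  have : 28 * e * nm th <= 4^-1 * nm th by rewrite ler_wpM2r ?nm_ge0//; lra.
  have : 0 <= K1 * e ^+ 2 by rewrite mulr_ge0.
  lra.
- exact: hx2.
- apply: le_lt_trans b4 _; have := Ke _ K40; lra.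
- split.
    have : ze * den2 e x = - (e%:C%C ^+ 4 * k ^+ 2).
      rewrite -{1}f2 /F2 rmorphXn -[waveno x]/k; by field.
    rewrite /den2 rmorphXn -[x.1.2]/ze => q.
    (* This is [z^2 - (i N)^2 = - k^2] in factored form; the power [e^4] in [den2] is undone. *)
    have q' : ze * (2 * 'i%C * N + ze) = - k ^+ 2.
      have : ze * (2 * 'i%C + e%:C%C ^+ 4 * 1 * ze) * e%:C%C ^- 4 = - k ^+ 2.
        by rewrite q; field.
      by move=> <-; rewrite NE; field.
    rewrite opprD -q' /z; have -> : N ^+ 2 = - ((N * 'i%C) ^+ 2).
      by rewrite exprMn sqr_i; ring.
    by ring.
  have : et * den3 e x = e%:C%C ^+ 2 * (B%:C%C * ze - k ^+ 2).
    rewrite -{1}f3 /F3 rmorphXn -[waveno x]/k -[x.1.2]/ze; by field.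
  rewrite /den3 rmorphXn -[x.2]/et rmorphM rmorph_nat => q.
  have q' : et * (2 * (beta%:C%C * (1 + 'i%C) * e%:C%C ^- 2) + et) = B%:C%C * ze - k ^+ 2.
    have : et * (2 * beta%:C%C * (1 + 'i%C) + e%:C%C ^+ 2 * 1 * et) * e%:C%C ^- 2 = B%:C%C * ze - k ^+ 2.
      by rewrite q; field.
    by move=> <-; field.
  have -> : B%:C%C * z - k ^+ 2 = B%:C%C * (N * 'i%C) + (B%:C%C * ze - k ^+ 2).
    by rewrite /z; ring.
  rewrite -q' kaE NE BC.
  (* Since [(1 + i)^2 = 2 i], the normalisation [2 beta^2 = B] makes the leading part of [kappa] a
     square root of [i N B]. *)
  have -> : 2 * beta%:C%C ^+ 2 * (e%:C%C ^- 4 * 'i%C) =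
     (beta%:C%C * (1 + 'i%C) * e%:C%C ^- 2) ^+ 2 :> R[i].
    rewrite !exprMn sqrrD expr1n sqr_i addrAC subrr add0r mulr_natl mul1r.
    by field.
  by ring.
- have sC : s%:C%C != 0 :> R[i] by rewrite n1// gt_eqF.
  have EE : expo e x = E by [].
  have : csin (s%:C%C * th) * (1 - E) = - (e%:C%C ^+ 2 * (k * ccos (s%:C%C * th) * (1 + E) / den1 e x)).
    move: f1; rewrite /F1a /F1b EE -[x.1.1]/th -[waveno x]/k.
    rewrite (rmorphV (real_complex R)) ?unitfE ?gt_eqF// rmorphXn.
    set u := csin _; set v := ccos _; set dd := den1 e x => f1'.
    have : s%:C%C * (th - (th - s%:C%C^-1 * u +
       s%:C%C^-1 * (u * E - e%:C%C ^+ 2 * 1 * (k * v * ((1 + E) * dd^-1))))) = 0.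
      by rewrite f1' subrr mulr0.
    move=> g; apply/eqP; rewrite -subr_eq0; apply/eqP; rewrite -g.
    by field; rewrite sC d1.
  move=> g.
  have kad : ka * e%:C%C ^+ 2 = den1 e x.
    by rewrite kaE /den1 rmorphXn -[x.2]/et; field.
have : ka * e%:C%C ^+ 2 != 0 by rewrite kad.
rewrite mulf_eq0 negb_or => /andP[ka0 _].
by rewrite -mulrA g -kad; field; rewrite ka0 eC.
Qed.

End ResonantPoint.

(** * Integration over the fundamental square *)

Section PlaneMeasurability.
Context {R : realType}.
Local Notation mu := (@lebesgue_measure R).
Local Notation leb2 := (mu \x mu)%E.

(** The product sigma-algebra contains boxes, and an open set is the countable union of the boxes
    with rational centre and half-side [1/(n+1)] that it contains. *)
Lemma open_prod_measurable (O : set (R * R)) : open O -> measurable O.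
Proof.
move=> oO.
pose box (t : rat * rat * nat) : set (R * R) :=
  `](ratr t.1.1 - t.2.+1%:R^-1), (ratr t.1.1 + t.2.+1%:R^-1)[%classic `*`
  `](ratr t.1.2 - t.2.+1%:R^-1), (ratr t.1.2 + t.2.+1%:R^-1)[%classic.
pose F t := if `[< box t `<=` O >] then box t else set0.
have -> : O = \bigcup_t F t.
  rewrite predeqE => -[x y]; split; last first.
    by move=> [t _]; rewrite /F; case: asboolP => // + h; apply.
  move=> Oxy; have : nbhs (x, y) O by exact: open_nbhs_nbhs.
  rewrite -nbhs_ballE => -[e /= e0 hO].
  (* Half-side below [e / 2]: every point of a box containing [(x, y)] is then within [e] of
     [(x, y)]. *)
  pose n := Num.truncn (2 / e).
  have en : n.+1%:R^-1 < e / 2.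
    rewrite -[ltRHS]invrK ltf_pV2 ?posrE ?invr_gt0 ?divr_gt0//.
    by rewrite invfM invrK mulrC truncnS_gt.
  pose d : R := n.+1%:R^-1; have d0 : 0 < d by rewrite invr_gt0.
  have xd : x - d < x + d by lra.
  have yd : y - d < y + d by lra.
  have [q hq] := rat_in_itvoo xd; have [r hr] := rat_in_itvoo yd.
  rewrite !in_itv/= in hq hr; exists (q, r, n) => //=; rewrite /F asboolT.
    by move: hq hr => /andP[q1 q2] /andP[r1 r2]; split; rewrite /= in_itv/= -/d; lra.
  move=> [a b] [/=]; rewrite !in_itv/= -/d => /andP[a1 a2] /andP[b1 b2].
  move: hq hr => /andP[q1 q2] /andP[r1 r2]; apply: hO; rewrite -/d in en.
  by split; rewrite /ball /= ltr_norml; apply/andP; split; lra.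
apply: countable_bigcupT_measurable => [|t]; first exact: countableP.
by rewrite /F; case: asboolP => // _; apply: measurableX; exact: measurable_itv.
Qed.

Lemma continuous_prod_measurable (f : R * R -> R) :
  continuous f -> measurable_fun setT f.
Proof.
move=> cf; apply: (measurability _ (RGenOpens.measurableE R)).
move=> _ [_ [a [b ->] <-]]; rewrite setTI; apply: open_prod_measurable.
by apply: open_comp => //; exact: interval_open.
Qed.

Lemma squareE : @square R = `[(- 2^-1), 2^-1[%classic `*` `[0, 1[%classic.
Proof.
rewrite predeqE => -[x y]; rewrite /square /=; split.
  by move=> [a b c d]; split; rewrite /= in_itv/=; apply/andP.
by move=> [/=]; rewrite !in_itv/= => /andP[? ?] /andP[].
Qed.

Lemma measurable_square : measurable (@square R).
Proof. by rewrite squareE; apply: measurableX; exact: measurable_itv. Qed.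

Lemma leb2_square : leb2 (@square R) = 1%E.
Proof.
rewrite squareE product_measure1E; try exact: measurable_itv.
rewrite [X in (X * _)%E]lebesgue_measure_itv [X in (_ * X)%E]lebesgue_measure_itv /= !lte_fin.
rewrite ltr01 ifT; last by lra.
rewrite -!EFinB opprK oppr0 addr0 mule1.
by congr (_%:E); lra.
Qed.

Definition bounded_on_square (f : R * R -> R) : Prop :=
  exists M, forall p, square p -> `|f p| <= M.

Lemma bounded_integrable d (T : measurableType d) (m : {measure set T -> \bar R})
  (D : set T) (f : T -> R) (M : R) : measurable D -> (m D < +oo)%E ->
  measurable_fun D f -> (forall x, D x -> `|f x| <= M) -> m.-integrable D (EFin \o f).
Proof.
move=> mD Dfin mf fM; apply: measurable_bounded_integrable => //.
exists M; split; first exact: num_real.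
by move=> K MK x Dx; apply: le_trans (fM _ Dx) (ltW MK).
Qed.

Lemma square_integrable (f : R * R -> R) : measurable_fun setT f ->
  bounded_on_square f -> leb2.-integrable (@square R) (EFin \o f).
Proof.
move=> mf [M fM]; apply: (@bounded_integrable _ _ leb2 _ _ M) => //; first exact: measurable_square.
  by rewrite [X in (X < _)%E]leb2_square ltry.
exact: measurable_funTS.
Qed.

(** Fubini with the inner integral in [x], after extending the integrand by 0 off the square. *)
Lemma square_integral_xsections (f : R * R -> R) : measurable_fun setT f ->
  bounded_on_square f ->
  (forall y : R, 0 <= y < 1 -> (\int[mu]_(x in `[(- 2^-1)%R, 2^-1%R[) (f (x, y))%:E = 0)%E) ->
  (\int[leb2]_(p in @square R) (f p)%:E = 0)%E.
Proof.
move=> mf bf hf; rewrite integral_mkcond -integral21_prod_meas1; last first.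
  exact: ((@integrable_mkcond _ _ _ leb2 (@square R) (EFin \o f) measurable_square).1 (square_integrable mf bf)).
apply: integral0_eq => y _; rewrite /fubini_G.
have [hy|hy] := boolP (0 <= y < 1).
  rewrite -[RHS](hf y hy) [RHS]integral_mkcond; apply: eq_integral => x _.
  rewrite !patchE squareE; congr (if _ then _ else _).
  apply/idP/idP; rewrite !inE; first by case.
  by move=> h; split => //=; rewrite in_itv.
apply: integral0_eq => x _; rewrite patchE squareE ifF//.
by apply/negP; rewrite inE => -[_ /=]; rewrite in_itv/=; exact/negP.
Qed.

Lemma square_integral_ysections (f : R * R -> R) : measurable_fun setT f ->
  bounded_on_square f ->
  (forall x : R, - 2^-1 <= x < 2^-1 -> (\int[mu]_(y in `[0%R, 1%R[) (f (x, y))%:E = 0)%E) ->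
  (\int[leb2]_(p in @square R) (f p)%:E = 0)%E.
Proof.
move=> mf bf hf; rewrite integral_mkcond -integral12_prod_meas1; last first.
  exact: ((@integrable_mkcond _ _ _ leb2 (@square R) (EFin \o f) measurable_square).1 (square_integrable mf bf)).
apply: integral0_eq => x _; rewrite /fubini_F.
have [hx|hx] := boolP (- 2^-1 <= x < 2^-1).
  rewrite -[RHS](hf x hx) [RHS]integral_mkcond; apply: eq_integral => y _.
  rewrite !patchE squareE; congr (if _ then _ else _).
  apply/idP/idP; rewrite !inE; first by case.
  by move=> h; split => //=; rewrite in_itv.
apply: integral0_eq => y _; rewrite patchE squareE ifF//.
by apply/negP; rewrite inE => -[/= + _]; rewrite in_itv/=; exact/negP.
Qed.

End PlaneMeasurability.

(** * Fundamental theorem of calculus on intervals *)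

Section IntervalIBP.
Context {R : realType}.
Local Notation mu := (@lebesgue_measure R).

Definition C1 (F f : R -> R) : Prop :=
  (forall x : R, is_derive x 1 F (f x)) /\ continuous f.

Lemma C1_continuous F f : C1 F f -> continuous F.
Proof.
move=> [dF _] x; apply: differentiable_continuous; apply/derivable1_diffP.
exact: ex_derive.
Qed.

Lemma C1_FTC F f (a b : R) : a < b -> C1 F f ->
  (\int[mu]_(x in `[a, b]) (f x)%:E = (F b - F a)%:E)%E.
Proof.
move=> ab CF; have cF := C1_continuous CF; have [dF cf] := CF.
rewrite (@continuous_FTC2 _ f F) ?EFinB//.
- exact: continuous_subspaceT.
- split => [x _||]; first exact: ex_derive.
  + by apply: cvg_at_right_filter; exact: cF.
  + by apply: cvg_at_left_filter; exact: cF.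
- by move=> x _; rewrite derive1E; apply: derive_val.
Qed.

Lemma C1M F f G g : C1 F f -> C1 G g ->
  C1 (fun x => F x * G x) (fun x => F x * g x + f x * G x).
Proof.
move=> CF CG; have cF := C1_continuous CF; have cG := C1_continuous CG.
case: CF CG => [dF cf] [dG cg]; split=> x.
  have := @is_deriveM _ _ F G x 1 (f x) (g x) (dF x) (dG x).
  rewrite [G x *: _]mulrC; exact.
by apply: cvgD; apply: cvgM; [exact: cF|exact: cg|exact: cf|exact: cG].
Qed.

End IntervalIBP.

(** * Weak derivatives *)

Section IBPOnInterval.
Context {R : realType}.
Local Notation mu := (@lebesgue_measure R).

(** [g] is the weak derivative of [h] on the circle obtained by identifying [a] and [b], whence the
    condition [psi a = psi b]. The single integral is the form that Fubini delivers on sections. *)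
Definition ibp_on (a b : R) (h g : R -> R) : Prop :=
  forall psi dpsi, C1 psi dpsi -> psi a = psi b ->
  (\int[mu]_(x in `[a, b[) (h x * dpsi x + g x * psi x)%:E = 0)%E.

Lemma C1_FTC_co F f (a b : R) : a < b -> C1 F f ->
  (\int[mu]_(x in `[a, b[) (f x)%:E = (F b - F a)%:E)%E.
Proof.
move=> ab CF; rewrite -(C1_FTC ab CF) integral_itv_bndo_bndc//.
apply/measurable_EFinP; apply: measurable_funTS; apply: continuous_measurable_fun.
exact: CF.2.
Qed.

Lemma C1_FTC_oo F f (a b : R) : a < b -> C1 F f ->
  (\int[mu]_(x in `]a, b[) (f x)%:E = (F b - F a)%:E)%E.
Proof.
move=> ab CF; rewrite -(C1_FTC_co ab CF) integral_itv_obnd_cbnd//.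
apply/measurable_EFinP; apply: measurable_funTS; apply: continuous_measurable_fun.
exact: CF.2.
Qed.

Lemma ibp_on_C1 a b F f : a < b -> C1 F f -> F a = F b -> ibp_on a b F f.
Proof.
move=> ab CF Fab psi dpsi Cpsi psiab.
by rewrite (C1_FTC_co ab (C1M CF Cpsi)) Fab psiab subrr.
Qed.

(** The middle piece owns both nodes, in agreement with [damping], which vanishes on the closed
    strip. *)
Definition glue (T : Type) (c d : R) (F1 F2 F3 : R -> T) (x : R) : T :=
  if x < c then F1 x else if x <= d then F2 x else F3 x.

Lemma measurable_glue c d (F1 F2 F3 : R -> R) : measurable_fun setT F1 ->
  measurable_fun setT F2 -> measurable_fun setT F3 ->
  measurable_fun setT (glue c d F1 F2 F3).
Proof.
move=> m1 m2 m3; apply: measurable_fun_ifT => //.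
  by apply: measurable_fun_ltr => //; exact: measurable_cst.
by apply: measurable_fun_ifT => //; apply: measurable_fun_ler => //; exact: measurable_cst.
Qed.

(** The integral over each piece is a boundary term. These telescope: continuity cancels them at [c]
    and [d], periodicity at the ends. The derivatives may jump at the nodes, as the second
    derivative of the mode does. *)
Lemma ibp_on_glue a b c d F1 f1 F2 f2 F3 f3 : a < c -> c < d -> d < b ->
  C1 F1 f1 -> C1 F2 f2 -> C1 F3 f3 ->
  F1 c = F2 c -> F2 d = F3 d -> F1 a = F3 b ->
  ibp_on a b (glue c d F1 F2 F3) (glue c d f1 f2 f3).
Proof.
move=> ac cd db C1F C2F C3F F12 F23 F13 psi dpsi Cpsi psiab.
pose q x := glue c d F1 F2 F3 x * dpsi x + glue c d f1 f2 f3 x * psi x.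
rewrite -[X in (X = _)%E]/(\int[mu]_(x in `[a, b[) (q x)%:E)%E.
have mC (F : R -> R) : continuous F -> measurable_fun setT F := @continuous_measurable_fun R F.
have mq : measurable_fun setT q.
  have [_ c1] := C1F; have [_ c2] := C2F; have [_ c3] := C3F; have [_ cp] := Cpsi.
  have := C1_continuous C1F; have := C1_continuous C2F; have := C1_continuous C3F.
  have := C1_continuous Cpsi => k0 k3 k2 k1.
  by apply: measurable_funD; apply: measurable_funM; try exact: mC;
    apply: measurable_glue; exact: mC.
have mqE D : measurable_fun D (fun x => (q x)%:E).
  by apply/measurable_EFinP; exact: measurable_funTS.
have -> : `[a, b[%classic = `[a, c[%classic `|` (`[c, d]%classic `|` `]d, b[%classic) :> set R.
  rewrite predeqE => x /=; rewrite !in_itv /=; split.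
    case/andP => ax xb; have [xc|cx] := ltP x c; first by left; rewrite ax.
    by right; have [xd|dx] := leP x d; [left|right]; rewrite ?cx ?xb.
  by move=> [/andP[x1 x2]|[/andP[x1 x2]|/andP[x1 x2]]]; apply/andP; split; lra.
have mI (i : interval R) : measurable [set` i] := measurable_itv i.
have dis1 : [disjoint `[a, c[ & `[c, d] `|` `]d, b[]%classic.
  apply/disj_setPLR => x /=; rewrite !in_itv /=.
  by move=> /andP[_ xc] [/andP[]|/andP[]]; lra.
have dis2 : [disjoint `[c, d] & `]d, b[]%classic.
  apply/disj_setPLR => x /=; rewrite !in_itv /=.
  by move=> /andP[_ xc] /andP[]; lra.
rewrite (@integral_setU _ _ _ mu _ _ _ (mI _) (measurableU _ _ (mI _) (mI _)) (mqE _) dis1).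
rewrite (@integral_setU _ _ _ mu _ _ _ (mI _) (mI _) (mqE _) dis2).
have -> : (\int[mu]_(x in `[a, c[) (q x)%:E = (F1 c * psi c - F1 a * psi a)%:E)%E.
  rewrite -(C1_FTC_co ac (C1M C1F Cpsi)); apply: eq_integral => x.
  by rewrite inE /= in_itv /= => /andP[_ xc]; rewrite /q /glue xc.
have -> : (\int[mu]_(x in `[c, d]) (q x)%:E = (F2 d * psi d - F2 c * psi c)%:E)%E.
  rewrite -(C1_FTC cd (C1M C2F Cpsi)); apply: eq_integral => x.
  by rewrite inE /= in_itv /= => /andP[cx xd]; rewrite /q /glue ltNge cx xd.
have -> : (\int[mu]_(x in `]d, b[) (q x)%:E = (F3 b * psi b - F3 d * psi d)%:E)%E.
  rewrite -(C1_FTC_oo db (C1M C3F Cpsi)); apply: eq_integral => x.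
  rewrite inE /= in_itv /= => /andP[dx xb].
  by rewrite /q /glue ltNge (ltW (lt_trans cd dx)) leNgt dx.
rewrite -!EFinD; congr (_%:E).
rewrite F12 F23 F13 psiab; lra.
Qed.

End IBPOnInterval.

(** * Smooth periodic test functions and their sections *)

Section TestFunctions.
Context {R : realType}.
Implicit Types (f phi : R * R -> R).

Lemma smooth_partial d f : smooth f -> smooth (partial d f).
Proof. by move=> sf s p; rewrite -foldr_rcons; exact: sf. Qed.

Lemma smooth_continuous f : smooth f -> continuous f.
Proof. by move=> sf p; apply: differentiable_continuous; exact: (sf [::]). Qed.

Lemma periodic_partial d f : Defs.periodic f -> Defs.periodic (partial d f).
Proof.
move=> pf.
have shift_partial (tau p : R * R) : (forall q, f (q + tau) = f q) ->
    partial d f (p + tau) = partial d f p.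
  move=> hf; rewrite /partial /derive.
  have -> // : (fun h : R => h^-1 *: ((f \o shift (p + tau)) (h *: dir R d) - f (p + tau))) =
      (fun h : R => h^-1 *: ((f \o shift p) (h *: dir R d) - f p)).
  by apply/funext => h /=; rewrite addrA !hf.
have addx (a b : R) : (a + 1, b) = (a, b) + (1, 0) :> R * R.
  by rewrite [RHS]surjective_pairing /= addr0.
have addy (a b : R) : (a, b + 1) = (a, b) + (0, 1) :> R * R.
  by rewrite [RHS]surjective_pairing /= addr0.
move=> x y; rewrite addx addy; split; apply: shift_partial => -[a b].
  by rewrite -addx (pf a b).1.
by rewrite -addy (pf a b).2.
Qed.

(** The difference quotient of the section is literally that of [f] along [(1, 0)]. *)
Lemma smooth_C1_x f y : smooth f ->
  C1 (fun x => f (x, y)) (fun x => partial false f (x, y)).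
Proof.
move=> sf; split => x; last first.
  apply: (@continuous_comp _ _ _ (fun x : R => (x, y)) (partial false f)).
    have h := @cvg_pair R R R (nbhs x) (nbhs x) (nbhs y) _ _ _ (fun t => t) (fun=> y).
    by apply: h; [exact: cvg_id|exact: cvg_cst].
  by apply: smooth_continuous; exact: smooth_partial.
have dfx : derivable f (x, y) (1, 0) := @diff_derivable _ _ _ _ _ _ (sf [::] (x, y)).
have e : (fun h : R => h^-1 *: (((fun x => f (x, y)) \o shift x) (h *: 1) - f (x, y))) =
   (fun h : R => h^-1 *: ((f \o shift (x, y)) (h *: ((1, 0) : R * R)) - f (x, y))).
  apply/funext => h /=; congr (_ *: (f _ - _)); rewrite [RHS]surjective_pairing /=.
  by congr (_, _); rewrite scaler0 add0r.
by apply: DeriveDef; rewrite /derivable /derive e.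
Qed.

Lemma smooth_C1_y f x : smooth f ->
  C1 (fun y => f (x, y)) (fun y => partial true f (x, y)).
Proof.
move=> sf; split => y; last first.
  apply: (@continuous_comp _ _ _ (fun y : R => (x, y)) (partial true f)).
    have h := @cvg_pair R R R (nbhs y) (nbhs x) (nbhs y) _ _ _ (fun=> x) (fun t => t).
    by apply: h; [exact: cvg_cst|exact: cvg_id].
  by apply: smooth_continuous; exact: smooth_partial.
have dfx : derivable f (x, y) (0, 1) := @diff_derivable _ _ _ _ _ _ (sf [::] (x, y)).
have e : (fun h : R => h^-1 *: (((fun y => f (x, y)) \o shift y) (h *: 1) - f (x, y))) =
   (fun h : R => h^-1 *: ((f \o shift (x, y)) (h *: ((0, 1) : R * R)) - f (x, y))).
  apply/funext => h /=; congr (_ *: (f _ - _)); rewrite [RHS]surjective_pairing /=.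
  by congr (_, _); rewrite scaler0 add0r.
by apply: DeriveDef; rewrite /derivable /derive e.
Qed.

Lemma continuous_bounded_on_square f : continuous f -> bounded_on_square f.
Proof.
move=> cf; pose K : set (R * R) := `[(- 2^-1), 2^-1]%classic `*` `[0, 1]%classic.
have cK : compact K by apply: compact_setX; exact: segment_compact.
have /compact_bounded[M [_ hM]] : compact (f @` K).
  by apply: continuous_compact => //; exact: continuous_subspaceT.
exists (M + 1) => -[x y] [/= x1 x2 y1 y2]; apply: (hM (M + 1)); first by rewrite ltrDl.
by exists (x, y) => //; split; rewrite /= in_itv /= ?x1 ?y1 ltW.
Qed.

End TestFunctions.

Section WeakDerivatives.
Context {R : realType}.
Local Notation leb2 := (@lebesgue_measure R \x @lebesgue_measure R)%E.
Implicit Types (a b : R * R -> R) (u g : R * R -> R[i]).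

Definition weak_partial d u g : Prop := forall phi : R * R -> R,
  smooth phi -> Defs.periodic phi ->
  torus_int (fun p => u p * (partial d phi p)%:C%C) =
  - torus_int (fun p => g p * (phi p)%:C%C).

Definition nice u : Prop :=
  [/\ measurable_fun setT (fun p => complex.Re (u p)),
      measurable_fun setT (fun p => complex.Im (u p)) &
      exists M, forall p, square p -> nm (u p) <= M].

(** Both integrals are put on one side, and Fubini reduces the claim to [ibp_on] on almost explicit
    sections: periodicity of [phi] makes each of its sections an admissible test function. *)
Lemma Rintegral_parts d a b : measurable_fun setT a -> measurable_fun setT b ->
  bounded_on_square a -> bounded_on_square b ->
  (forall t : R, (if d then - 2^-1 <= t < 2^-1 else 0 <= t < 1) ->
     if d then ibp_on 0 1 (fun y => a (t, y)) (fun y => b (t, y))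
     else ibp_on (- 2^-1) (2^-1) (fun x => a (x, t)) (fun x => b (x, t))) ->
  forall phi, smooth phi -> Defs.periodic phi ->
  Rintegral leb2 (@square R) (fun p => a p * partial d phi p) =
  - Rintegral leb2 (@square R) (fun p => b p * phi p).
Proof.
move=> ma mb ba bb hab phi sphi pphi.
have cphi := smooth_continuous sphi.
have cdphi := smooth_continuous (smooth_partial d sphi).
have mphi := continuous_prod_measurable cphi.
have mdphi := continuous_prod_measurable cdphi.
have bM (f g : R * R -> R) : bounded_on_square f -> bounded_on_square g ->
    bounded_on_square (fun p => f p * g p : R).
  move=> [M hM] [K hK]; exists (M * K) => p hp; rewrite normrM.
  by apply: ler_pM => //; [exact: hM|exact: hK].
have b1 := bM _ _ ba (continuous_bounded_on_square cdphi).
have b2 := bM _ _ bb (continuous_bounded_on_square cphi).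
have m1 : measurable_fun setT (fun p : R * R => a p * partial d phi p) by exact: measurable_funM.
have m2 : measurable_fun setT (fun p : R * R => b p * phi p) by exact: measurable_funM.
apply/eqP; rewrite -addr_eq0 -RintegralD; [|exact: measurable_square|exact: square_integrable..].
have m12 : measurable_fun setT (fun p : R * R => a p * partial d phi p + b p * phi p).
  exact: measurable_funD.
have b12 : bounded_on_square (fun p => a p * partial d phi p + b p * phi p).
  case: b1 b2 => [M hM] [K hK]; exists (M + K) => p hp.
  by apply: le_trans (ler_normD _ _) _; apply: lerD; [exact: hM|exact: hK].
apply/eqP; rewrite /Rintegral.
case: d hab cdphi mdphi b1 m1 m12 b12 => hab cdphi mdphi b1 m1 m12 b12.
- rewrite (square_integral_ysections m12 b12)// => x hx.
  have := hab x hx _ _ (smooth_C1_y x sphi); apply.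
  by have := (pphi x 0).2; rewrite add0r.
- rewrite (square_integral_xsections m12 b12)// => y hy.
  have := hab y hy _ _ (smooth_C1_x y sphi); apply.
  by have := (pphi (- 2^-1) y).1; rewrite -[RHS]/(phi _) => <-; congr (phi (_, _)); lra.
Qed.

Lemma nice_weak_partial d u g : nice u -> nice g ->
  (forall t : R, (if d then - 2^-1 <= t < 2^-1 else 0 <= t < 1) ->
     if d then ibp_on 0 1 (fun y => complex.Re (u (t, y))) (fun y => complex.Re (g (t, y))) /\
       ibp_on 0 1 (fun y => complex.Im (u (t, y))) (fun y => complex.Im (g (t, y)))
     else ibp_on (- 2^-1) (2^-1) (fun x => complex.Re (u (x, t))) (fun x => complex.Re (g (x, t))) /\
      ibp_on (- 2^-1) (2^-1) (fun x => complex.Im (u (x, t))) (fun x => complex.Im (g (x, t)))) ->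
  weak_partial d u g.
Proof.
move=> [u1 u2 [M hM]] [g1 g2 [K hK]] h phi sphi pphi.
have re (z : R[i]) (c : R) : complex.Re (z * c%:C%C) = complex.Re z * c.
  by rewrite cReM /= mulr0 subr0.
have im (z : R[i]) (c : R) : complex.Im (z * c%:C%C) = complex.Im z * c.
  by rewrite cImM /= mulr0 add0r.
rewrite /torus_int.
have e1 := @Rintegral_parts d (fun p => complex.Re (u p)) (fun p => complex.Re (g p)) u1 g1.
have e2 := @Rintegral_parts d (fun p => complex.Im (u p)) (fun p => complex.Im (g p)) u2 g2.
apply: complex_eqP => /=.
- under eq_Rintegral do rewrite re; under [in RHS]eq_Rintegral do rewrite re.
  apply: e1 => //.
  + by exists M => p /hM; apply: le_trans; exact: nm_Re.
  + by exists K => p /hK; apply: le_trans; exact: nm_Re.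
  + by move=> t /h; case: (d) => -[].
- under eq_Rintegral do rewrite im; under [in RHS]eq_Rintegral do rewrite im.
  apply: e2 => //.
  + by exists M => p /hM; apply: le_trans; exact: nm_Im.
  + by exists K => p /hK; apply: le_trans; exact: nm_Im.
  + by move=> t /h; case: (d) => -[].
Qed.

Lemma smooth_mderiv j k (phi : R * R -> R) : smooth phi -> smooth (mderiv j k phi).
Proof.
move=> sphi; rewrite /mderiv; elim: j => [|j ih] /=; last exact: smooth_partial.
by elim: k => [|k ih] //=; exact: smooth_partial.
Qed.

Lemma periodic_mderiv j k (phi : R * R -> R) : Defs.periodic phi -> Defs.periodic (mderiv j k phi).
Proof.
move=> sphi; rewrite /mderiv; elim: j => [|j ih] /=; last exact: periodic_partial.
by elim: k => [|k ih] //=; exact: periodic_partial.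
Qed.

Lemma weak_deriv00 u : weak_deriv 0 0 u u.
Proof. by move=> phi _ _; rewrite expr0 mul1r. Qed.

(** [mderiv] applies the [x]-derivatives last, so one of them can be moved onto [u] with the smooth
    periodic test function [mderiv j k phi]. *)
Lemma weak_deriv_stepx j k u g1 g :
  weak_partial false u g1 -> weak_deriv j k g1 g -> weak_deriv j.+1 k u g.
Proof.
move=> h1 h2 phi sphi pphi.
have := h1 _ (smooth_mderiv j k sphi) (periodic_mderiv j k pphi).
by rewrite (h2 phi sphi pphi) addSn exprS mulN1r mulNr => <-.
Qed.

(** Stated for [j = 0], where a [y]-derivative is outermost; a mixed derivative is reached by an
    [x]-step followed by a [y]-step. *)
Lemma weak_deriv_stepy k u g1 g :
  weak_partial true u g1 -> weak_deriv 0 k g1 g -> weak_deriv 0 k.+1 u g.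
Proof.
move=> h1 h2 phi sphi pphi.
have := h1 _ (smooth_mderiv 0 k sphi) (periodic_mderiv 0 k pphi).
by rewrite (h2 phi sphi pphi) !add0n exprS mulN1r mulNr => <-.
Qed.

Lemma nice_L2 u : nice u -> L2 u.
Proof.
move=> [m1 m2 [M hM]]; split; [exact: measurable_funTS..|].
have mn : measurable_fun setT (fun p => nm (u p) ^+ 2).
  under eq_fun do rewrite nm_sqr.
  by apply: measurable_funD; apply: measurable_funX.
have : leb2.-integrable (@square R) (EFin \o (fun p => nm (u p) ^+ 2)).
  apply: square_integrable => //; exists (M ^+ 2) => p hp.
  rewrite ger0_norm ?sqr_ge0// ler_sqr ?nnegrE ?nm_ge0 ?hM//.
  exact: le_trans (nm_ge0 _) (hM _ hp).
move=> /integrableP[_]; apply: le_lt_trans.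
rewrite le_eqVlt; apply/orP; left; apply/eqP; apply: eq_integral => p _ /=.
by rewrite ger0_norm// sqr_ge0.
Qed.

End WeakDerivatives.

(** * Separated functions *)

Section ComplexC1.
Context {R : realType}.
Implicit Types (F f : R -> R) (V : R -> R[i]) (a c w : R[i]).

Definition complex_C1 V V' : Prop :=
  C1 (fun x => complex.Re (V x)) (fun x => complex.Re (V' x)) /\
  C1 (fun x => complex.Im (V x)) (fun x => complex.Im (V' x)).

Lemma C1_ext F f G g : C1 F f -> F =1 G -> f =1 g -> C1 G g.
Proof. by move=> h /funext <- /funext <-. Qed.

Lemma C1D F f G g : C1 F f -> C1 G g -> C1 (fun x => F x + G x) (fun x => f x + g x).
Proof.
move=> [dF cf] [dG cg]; split=> x; first exact: is_deriveD.
by apply: cvgD; [exact: cf|exact: cg].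
Qed.

Lemma C1Z (k : R) F f : C1 F f -> C1 (fun x => k * F x) (fun x => k * f x).
Proof.
move=> [dF cf]; split=> x; first exact: is_deriveZ.
by apply: cvgM; [exact: cvg_cst|exact: cf].
Qed.

Lemma complex_C1_ext V V' U U' : complex_C1 V V' -> V =1 U -> V' =1 U' -> complex_C1 U U'.
Proof. by move=> h /funext <- /funext <-. Qed.

Lemma complex_C1D V V' U U' : complex_C1 V V' -> complex_C1 U U' ->
  complex_C1 (fun x => V x + U x) (fun x => V' x + U' x).
Proof.
by move=> [v1 v2] [u1 u2]; split; [apply: C1_ext (C1D v1 u1) _ _|apply: C1_ext (C1D v2 u2) _ _] => x;
  rewrite ?cReD ?cImD.
Qed.

Lemma complex_C1Z c V V' : complex_C1 V V' ->
  complex_C1 (fun x => c * V x) (fun x => c * V' x).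
Proof.
move=> [v1 v2]; split.
- apply: C1_ext (C1D (C1Z (complex.Re c) v1) (C1Z (- complex.Im c) v2)) _ _ => x;
  by rewrite cReM mulNr.
- apply: C1_ext (C1D (C1Z (complex.Re c) v2) (C1Z (complex.Im c) v1)) _ _ => x;
  by rewrite cImM.
Qed.

Lemma complex_C1_cexp a :
  complex_C1 (fun x => cexp (a * x%:C%C)) (fun x => a * cexp (a * x%:C%C)).
Proof.
set al := complex.Re a; set be := complex.Im a.
have lin (k : R) (G g : R -> R) : (forall x : R, is_derive x 1 G (g x)) ->
    forall x : R, is_derive x 1 (fun t => G (k * t)) (k * g (k * x)).
  move=> dG x.
  have dk : is_derive x 1 (fun t : R => k * t) (k * 1).
    exact: (is_deriveZ (f := id)).
  have := @is_derive1_comp _ G (fun t => k * t) x _ _ (dG (k * x)) dk.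
  by rewrite mulr1 mulrC.
have ck (k : R) (G : R -> R) : continuous G -> continuous (fun t => G (k * t)).
  move=> cG x; apply: (@continuous_comp _ _ _ ( *%R k) G); last exact: cG.
  exact: mulrl_continuous.
have Ce : C1 (fun x : R => expR (al * x)) (fun x => al * expR (al * x)).
  split=> [x|x]; first exact: lin.
  by apply: cvgM; [exact: cvg_cst|apply: ck; exact: continuous_expR].
have Cc : C1 (fun x : R => cos (be * x)) (fun x => be * - sin (be * x)).
  split=> [x|x]; first exact: (lin be cos (fun x => - sin x)).
  apply: cvgM; [exact: cvg_cst|apply: (ck be (fun x => - sin x)) => y].
  by apply: cvgN; exact: continuous_sin.
have Cs : C1 (fun x : R => sin (be * x)) (fun x => be * cos (be * x)).
  split=> [x|x]; first exact: lin.
  by apply: cvgM; [exact: cvg_cst|apply: ck; exact: continuous_cos].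
have re x : complex.Re (a * x%:C%C) = al * x by rewrite cReM /= mulr0 subr0.
have im x : complex.Im (a * x%:C%C) = be * x by rewrite cImM /= mulr0 add0r.
split.
- apply: C1_ext (C1M Ce Cc) _ _ => x; rewrite /cexp re im //.
  by rewrite cReM /= -/al -/be; ring.
- apply: C1_ext (C1M Ce Cs) _ _ => x; rewrite /cexp re im //.
  by rewrite cImM /= -/al -/be; ring.
Qed.

(** The general form of the solutions of [f'' = a^2 f], closed under differentiation. Every piece of
    the mode is of this form. *)
Definition expsum c1 c2 a (x : R) : R[i] :=
  c1 * cexp (a * x%:C%C) + c2 * cexp (- (a * x%:C%C)).

Lemma complex_C1_expsum c1 c2 a :
  complex_C1 (expsum c1 c2 a) (expsum (a * c1) (- (a * c2)) a).
Proof.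
have h := complex_C1D (complex_C1Z c1 (complex_C1_cexp a))
  (complex_C1Z c2 (complex_C1_cexp (- a))).
apply: complex_C1_ext h _ _ => x; rewrite /expsum (mulNr a x%:C%C)//; ring.
Qed.

Lemma expsum_opp c1 c2 a x : expsum c2 c1 a x = expsum c1 c2 a (- x).
Proof. by rewrite /expsum rmorphN mulrN opprK addrC. Qed.

Lemma expsum_deriv2 c1 c2 a x :
  expsum (a * (a * c1)) (- (a * - (a * c2))) a x = a ^+ 2 * expsum c1 c2 a x.
Proof. by rewrite /expsum; ring. Qed.

(** The range [|x| <= 1] covers both sides of the fundamental square. *)
Definition locally_bounded_measurable V : Prop :=
  [/\ measurable_fun setT (fun x => complex.Re (V x)),
      measurable_fun setT (fun x => complex.Im (V x)) &
      exists M, forall x, `|x| <= 1 -> nm (V x) <= M].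

Lemma complex_C1_lbm V V' : complex_C1 V V' -> locally_bounded_measurable V.
Proof.
move=> [/C1_continuous c1 /C1_continuous c2].
split; [exact: continuous_measurable_fun..|].
have bnd (F : R -> R) : continuous F -> exists M, forall x, `|x| <= 1 -> `|F x| <= M.
  move=> cF; have /compact_bounded[M [_ hM]] : compact (F @` `[(- 1), 1]%classic).
    by apply: continuous_compact; [exact: continuous_subspaceT|exact: segment_compact].
  exists (M + 1) => x x1; apply: (hM (M + 1)); first by rewrite ltrDl.
  by exists x => //=; rewrite in_itv /= -ler_norml.
have [M hM] := bnd _ c1; have [K hK] := bnd _ c2.
exists (M + K) => x x1; apply: le_trans (nm_le_ReIm _) _.
by apply: lerD; [exact: hM|exact: hK].
Qed.

Lemma glue_map (T U : Type) (h : T -> U) (c d : R) (F1 F2 F3 : R -> T) x :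
  h (glue c d F1 F2 F3 x) = glue c d (fun t => h (F1 t)) (fun t => h (F2 t)) (fun t => h (F3 t)) x.
Proof. by rewrite /glue; case: ifP => // _; case: ifP. Qed.

Lemma glue_lbm (c d : R) (F1 F2 F3 : R -> R[i]) : locally_bounded_measurable F1 ->
  locally_bounded_measurable F2 -> locally_bounded_measurable F3 ->
  locally_bounded_measurable (glue c d F1 F2 F3).
Proof.
move=> [a1 a2 [M1 h1]] [b1 b2 [M2 h2]] [c1 c2 [M3 h3]]; split.
- by under eq_fun do rewrite glue_map; exact: measurable_glue.
- by under eq_fun do rewrite glue_map; exact: measurable_glue.
exists (Num.max M1 (Num.max M2 M3)) => x x1; rewrite glue_map /glue.
by case: ifP => _; [|case: ifP => _]; rewrite !le_max ?h1 ?h2 ?h3 ?orbT.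
Qed.

Definition complex_ibp_on (a b : R) V V' : Prop :=
  ibp_on a b (fun x => complex.Re (V x)) (fun x => complex.Re (V' x)) /\
  ibp_on a b (fun x => complex.Im (V x)) (fun x => complex.Im (V' x)).

Lemma ibp_on_ext (a b : R) F f G g : ibp_on a b F f -> F =1 G -> f =1 g -> ibp_on a b G g.
Proof. by move=> h /funext <- /funext <-. Qed.

Lemma complex_ibp_on_C1 (a b : R) V V' : a < b -> complex_C1 V V' -> V a = V b ->
  complex_ibp_on a b V V'.
Proof. by move=> ab [v1 v2] Vab; split; apply: ibp_on_C1 => //; rewrite Vab. Qed.

(** The factor [w] stands for the value of the other tensor factor on a section; multiplying by it
    mixes real and imaginary parts, so it is carried along. *)
Lemma complex_ibp_on_glue (a b c d : R) (F1 f1 F2 f2 F3 f3 : R -> R[i]) : a < c -> c < d -> d < b ->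
  complex_C1 F1 f1 -> complex_C1 F2 f2 -> complex_C1 F3 f3 ->
  F1 c = F2 c -> F2 d = F3 d -> F1 a = F3 b -> forall w,
  complex_ibp_on a b (fun x => w * glue c d F1 F2 F3 x) (fun x => w * glue c d f1 f2 f3 x).
Proof.
move=> ac cd db C1 C2 C3 e1 e2 e3 w.
have [p1 q1] := complex_C1Z w C1; have [p2 q2] := complex_C1Z w C2.
have [p3 q3] := complex_C1Z w C3; split.
  apply: ibp_on_ext (ibp_on_glue ac cd db p1 p2 p3 _ _ _) _ _ => [|||x|x]; rewrite ?e1 ?e2 ?e3//.
    by rewrite (glue_map (fun v => complex.Re (w * v))).
  by rewrite (glue_map (fun v => complex.Re (w * v))).
apply: ibp_on_ext (ibp_on_glue ac cd db q1 q2 q3 _ _ _) _ _ => [|||x|x]; rewrite ?e1 ?e2 ?e3//.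
  by rewrite (glue_map (fun v => complex.Im (w * v))).
by rewrite (glue_map (fun v => complex.Im (w * v))).
Qed.

Lemma nice_tensor V U : locally_bounded_measurable V -> locally_bounded_measurable U ->
  nice (fun p => V p.1 * U p.2).
Proof.
move=> [v1 v2 [M hM]] [u1 u2 [K hK]].
have mf (F : R -> R) : measurable_fun setT F -> measurable_fun setT (fun p : R * R => F p.1).
  by move=> mF; apply: (measurableT_comp mF); exact: measurable_fst.
have ms (F : R -> R) : measurable_fun setT F -> measurable_fun setT (fun p : R * R => F p.2).
  by move=> mF; apply: (measurableT_comp mF); exact: measurable_snd.
have p1 := mf _ v1; have p2 := mf _ v2; have q1 := ms _ u1; have q2 := ms _ u2.
split.
- under eq_fun do rewrite cReM.
  by apply: measurable_funB; exact: measurable_funM.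
- under eq_fun do rewrite cImM.
  by apply: measurable_funD; exact: measurable_funM.
exists (M * K) => -[x y] [/= x1 x2 y1 y2]; rewrite nmM.
apply: ler_pM; rewrite ?nm_ge0//.
  by apply: hM; rewrite ler_norml; apply/andP; split; lra.
by apply: hK; rewrite ler_norml; apply/andP; split; lra.
Qed.

Lemma tensor_weak_partial_x V V' U : locally_bounded_measurable V ->
  locally_bounded_measurable V' -> locally_bounded_measurable U ->
  (forall w, complex_ibp_on (- 2^-1) 2^-1 (fun x => w * V x) (fun x => w * V' x)) ->
  weak_partial false (fun p => V p.1 * U p.2) (fun p => V' p.1 * U p.2).
Proof.
move=> v v' u h; apply: nice_weak_partial; [exact: nice_tensor..|move=> t _ /=].
have [h1 h2] := h (U t); split.
  by apply: ibp_on_ext h1 _ _ => x; rewrite mulrC.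
by apply: ibp_on_ext h2 _ _ => x; rewrite mulrC.
Qed.

Lemma tensor_weak_partial_y V U U' : locally_bounded_measurable V ->
  locally_bounded_measurable U -> locally_bounded_measurable U' ->
  (forall w, complex_ibp_on 0 1 (fun x => w * U x) (fun x => w * U' x)) ->
  weak_partial true (fun p => V p.1 * U p.2) (fun p => V p.1 * U' p.2).
Proof.
move=> v u u' h; apply: nice_weak_partial; [exact: nice_tensor..|move=> t _ /=].
exact: h (V t).
Qed.

End ComplexC1.

Section SeparatedMode.
Context {R : realType}.
Local Notation leb2 := (@lebesgue_measure R \x @lebesgue_measure R)%E.

(** The strip [|x| < d], [0 < y < 1] would be negligible, yet its measure is [2 d]. *)
Lemma not_ae_zero (u : R * R -> R[i]) (d : R) : 0 < d <= 2^-1 ->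
  (forall p, `|p.1| < d -> u p != 0) -> ~ ae_eq_torus u (fun=> 0).
Proof.
move=> /andP[d0 d1] hu; rewrite /ae_eq_torus => ae0.
pose S : set (R * R) := `](- d), d[%classic `*` `]0, 1[%classic.
have mS : measurable S by apply: measurableX; exact: measurable_itv.
have : leb2 S = 0%E.
  apply: (@negligibleP _ _ _ leb2 S mS).1; apply: negligibleS ae0 => -[x y] [/=]; rewrite !in_itv /=.
  move=> xd /andP[y0 y1] /= hp.
  have : u (x, y) != 0 by apply: hu; rewrite /= ltr_norml.
  rewrite hp ?eqxx//; split => /=; lra.
rewrite product_measure1E; try exact: measurable_itv.
rewrite [X in (X * _)%E]lebesgue_measure_itv [X in (_ * X)%E]lebesgue_measure_itv /= !lte_fin.
rewrite ltr01 ifT; last by lra.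
by rewrite -!EFinB -EFinM => -[]; lra.
Qed.

Variables (sigma B : R) (z : R[i]).
Variables (V V1 V2 U U1 U2 : R -> R[i]).
Hypotheses (lV : locally_bounded_measurable V) (lV1 : locally_bounded_measurable V1)
  (lV2 : locally_bounded_measurable V2) (lU : locally_bounded_measurable U)
  (lU1 : locally_bounded_measurable U1) (lU2 : locally_bounded_measurable U2).
Hypotheses
  (hV : forall w, complex_ibp_on (- 2^-1) 2^-1 (fun x => w * V x) (fun x => w * V1 x))
  (hV1 : forall w, complex_ibp_on (- 2^-1) 2^-1 (fun x => w * V1 x) (fun x => w * V2 x))
  (hU : forall w, complex_ibp_on 0 1 (fun x => w * U x) (fun x => w * U1 x))
  (hU1 : forall w, complex_ibp_on 0 1 (fun x => w * U1 x) (fun x => w * U2 x)).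

Lemma separated_mode_spectrum (d : R) : 0 < d <= 2^-1 ->
  (forall x, `|x| < d -> V x != 0) -> (forall y, U y != 0) ->
  (forall x y, - (V2 x * U y + V x * U2 y) + z * (damping sigma B (x, y))%:C%C * (V x * U y)
     + z ^+ 2 * (V x * U y) = 0) ->
  spectrum (damping sigma B) z.
Proof.
move=> hd V0 U0 heq.
pose u (f g : R -> R[i]) (p : R * R) := f p.1 * g p.2.
have x1 := @tensor_weak_partial_x _ V V1 U lV lV1 lU hV.
have x2 := @tensor_weak_partial_x _ V1 V2 U lV1 lV2 lU hV1.
have y1 := @tensor_weak_partial_y _ V U U1 lV lU lU1 hU.
have y2 := @tensor_weak_partial_y _ V U1 U2 lV lU1 lU2 hU1.
have xy := @tensor_weak_partial_y _ V1 U U1 lV1 lU lU1 hU.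
have L f g : locally_bounded_measurable f -> locally_bounded_measurable g -> L2 (u f g).
  by move=> lf lg; apply: nice_L2; exact: nice_tensor.
have w20 : weak_deriv 2 0 (u V U) (u V2 U).
  apply: weak_deriv_stepx x1 _; apply: weak_deriv_stepx x2 _; exact: weak_deriv00.
have w02 : weak_deriv 0 2 (u V U) (u V U2).
  apply: weak_deriv_stepy y1 _; apply: weak_deriv_stepy y2 _; exact: weak_deriv00.
exists (u V U); split.
- split; first exact: L.
  move=> [|[|[|j]]] [|[|[|k]]] // _.
  + by exists (u V U); [exact: L|exact: weak_deriv00].
  + exists (u V U1); [exact: L|apply: weak_deriv_stepy y1 _; exact: weak_deriv00].
  + by exists (u V U2); [exact: L|].
  + exists (u V1 U); [exact: L|apply: weak_deriv_stepx x1 _; exact: weak_deriv00].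
  + exists (u V1 U1); [exact: L|apply: weak_deriv_stepx x1 _].
    apply: weak_deriv_stepy xy _; exact: weak_deriv00.
  + by exists (u V2 U); [exact: L|].
- by apply: (not_ae_zero hd) => p hp; rewrite mulf_neq0// V0.
- exists (fun p => u V2 U p + u V U2 p).
    exists (u V2 U), (u V U2); split; [by split; [exact: L|]|by split; [exact: L|]|].
    by apply: aeW => p _.
  by apply: aeW => -[x y] _; exact: heq.
Qed.

End SeparatedMode.

(** * The eigenfunction *)

Section ModeOfRoot.
Context {R : realType}.
Variables (sigma B N : R) (z k ka : R[i]).
Hypotheses (hs : 0 < sigma < 2^-1).
Let L : R := 2^-1 - sigma.
Let E : R[i] := cexp (- ((2 * L)%:C%C * ka)).
Hypotheses (hN : cexp ('i%C * N%:C%C) = 1) (hE : nm E < 1)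
  (hz : z ^+ 2 = - (N%:C%C ^+ 2 + k ^+ 2)) (hka : ka ^+ 2 = B%:C%C * z - k ^+ 2)
  (hk : k * csin (k * sigma%:C%C) * (1 + E) = ka * ccos (k * sigma%:C%C) * (1 - E)).

(* The mode is multiplied by [2 exp(-q)], which avoids dividing by [cosh q]. *)
Let q : R[i] := L%:C%C * ka.
Let amp : R[i] := ccos (k * sigma%:C%C).
(** With these coefficients [right0 x = 2 amp exp(-q) cosh(ka (1/2 - x))]. *)
Let c1 : R[i] := amp * cexp (- (ka / 2) - q).
Let c2 : R[i] := amp * cexp (ka / 2 - q).
(** Since [2 exp(-q) cosh q = 1 + E], the middle piece is [(1 + E) cos(k x)], and the value [amp]
    makes it meet [right0] at [sigma]. *)
Let m : R[i] := (1 + E) / 2.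
Let a : R[i] := 'i%C * k.

(** Swapping the coefficients reflects [x], so the mode is even and the matching at [- sigma]
    follows from that at [sigma]. *)
Let left0 := expsum c2 c1 ka.
Let left1 := expsum (ka * c2) (- (ka * c1)) ka.
Let left2 := expsum (ka * (ka * c2)) (- (ka * - (ka * c1))) ka.
Let mid0 := expsum m m a.
Let mid1 := expsum (a * m) (- (a * m)) a.
Let mid2 := expsum (a * (a * m)) (- (a * - (a * m))) a.
Let right0 := expsum c1 c2 ka.
Let right1 := expsum (ka * c1) (- (ka * c2)) ka.
Let right2 := expsum (ka * (ka * c1)) (- (ka * - (ka * c2))) ka.

Let y0 (y : R) : R[i] := cexp ('i%C * N%:C%C * y%:C%C).
Let y1 (y : R) : R[i] := 'i%C * N%:C%C * y0 y.
Let y2 (y : R) : R[i] := 'i%C * N%:C%C * y1 y.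

Let half : (2^-1 : R)%:C%C = 2^-1 :> R[i].
Proof. by rewrite (rmorphV (real_complex R)) ?unitfE// rmorph_nat. Qed.

Let EE : E = cexp (- q - q).
Proof. by rewrite /E /q rmorphM rmorph_nat; congr cexp; ring. Qed.

Let sigL : sigma%:C%C = 2^-1 - L%:C%C :> R[i].
Proof. by rewrite -half -rmorphB; congr (_%:C%C); rewrite /L; ring. Qed.

Let right0_sigma : right0 sigma = amp * (1 + E).
Proof.
rewrite /right0 /expsum /c1 /c2; generalize amp => w; rewrite -!mulrA -!cexpD -mulrDr; congr (_ * _).
have -> : - (ka / 2) - q + ka * sigma%:C%C = - q - q by rewrite sigL /q; field.
have -> : ka / 2 - q - ka * sigma%:C%C = 0 by rewrite sigL /q; field.
by rewrite cexp0 -EE addrC.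
Qed.

Let right1_sigma : right1 sigma = - (ka * amp * (1 - E)).
Proof.
rewrite /right1 /expsum /c1 /c2.
have -> : ka * (amp * cexp (- (ka / 2) - q)) * cexp (ka * sigma%:C%C) +
   - (ka * (amp * cexp (ka / 2 - q))) * cexp (- (ka * sigma%:C%C)) =
   ka * amp * (cexp (- (ka / 2) - q + ka * sigma%:C%C) - cexp (ka / 2 - q - ka * sigma%:C%C)).
  by rewrite (cexpD (- (ka / 2) - q)) (cexpD (ka / 2 - q)); ring.
have -> : - (ka / 2) - q + ka * sigma%:C%C = - q - q by rewrite sigL /q; field.
have -> : ka / 2 - q - ka * sigma%:C%C = 0 by rewrite sigL /q; field.
by rewrite cexp0 -EE; ring.
Qed.

Let mid0E x : mid0 x = (1 + E) * ccos (k * x%:C%C).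
Proof. by rewrite /mid0 /expsum /ccos /m /a !mulrA; field. Qed.

Let mid1E x : mid1 x = - (k * csin (k * x%:C%C) * (1 + E)).
Proof.
have i0 := @ci_neq0 R.
have i2 : 'i%C * 'i%C = - 1 :> R[i] by rewrite -expr2 sqr_i.
rewrite /mid1 /expsum /csin /m /a !mulrA; set u := cexp _; set v := cexp _.
have -> : k * (u - v) / (2 * 'i%C) = - ('i%C * k * (u - v) / 2).
  apply: (mulfI (mulf_neq0 (_ : 2 != 0 :> R[i]) i0)); first by rewrite pnatr_eq0.
  have -> : 2 * 'i%C * (k * (u - v) / (2 * 'i%C)) = k * (u - v) by field.
  have -> : 2 * 'i%C * (- ('i%C * k * (u - v) / 2)) = - ('i%C * 'i%C) * (k * (u - v)) by field.
  by rewrite i2 opprK mul1r.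
by field.
Qed.

Let match0 : mid0 sigma = right0 sigma.
Proof. by rewrite right0_sigma mid0E mulrC. Qed.

(** Continuity of the slope at [sigma] is exactly the characteristic equation [hk]. *)
Let match1 : mid1 sigma = right1 sigma.
Proof. by rewrite right1_sigma mid1E hk. Qed.

(** The slope is odd in [x], so it is 1-periodic across [x = 1/2] because it vanishes there. *)
Let right1_half : right1 2^-1 = 0.
Proof.
rewrite /right1 /expsum /c1 /c2 half mulNr.
have -> : ka * (amp * cexp (- (ka / 2) - q)) * cexp (ka / 2) -
   ka * (amp * cexp (ka / 2 - q)) * cexp (- (ka / 2)) =
   ka * amp * (cexp (- (ka / 2) - q + ka / 2) - cexp (ka / 2 - q - ka / 2)).
  by rewrite (cexpD (- (ka / 2) - q)) (cexpD (ka / 2 - q)); ring.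
rewrite (_ : - (ka / 2) - q + ka / 2 = ka / 2 - q - ka / 2); last by ring.
by rewrite subrr mulr0.
Qed.

Let expsum_opp1 b d e x : expsum (e * d) (- (e * b)) e x = - expsum (e * b) (- (e * d)) e (- x) :> R[i].
Proof. by rewrite /expsum rmorphN !mulrN opprK; ring. Qed.

(** [1 + E] is the value of the mode's [x]-factor at 0, so this keeps the mode from being
    trivial. *)
Let E1 : 1 + E != 0.
Proof.
rewrite -nm_gt0; have := nm_subadd 1 E; rewrite (Normc.normc1 R); move: hE; lra.
Qed.

Let s0 : 0 < sigma. Proof. by case/andP: hs. Qed.

Lemma mode_of_root : spectrum (damping sigma B) z.
Proof.
have [sp s1] := andP hs.
have lC V V' : complex_C1 V V' -> locally_bounded_measurable V := @complex_C1_lbm R V V'.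
have cl0 : complex_C1 left0 left1 := complex_C1_expsum _ _ _.
have cl1 : complex_C1 left1 left2 := complex_C1_expsum _ _ _.
have cl2 : complex_C1 left2 _ := complex_C1_expsum _ _ _.
have cm0 : complex_C1 mid0 mid1 := complex_C1_expsum _ _ _.
have cm1 : complex_C1 mid1 mid2 := complex_C1_expsum _ _ _.
have cm2 : complex_C1 mid2 _ := complex_C1_expsum _ _ _.
have cr0 : complex_C1 right0 right1 := complex_C1_expsum _ _ _.
have cr1 : complex_C1 right1 right2 := complex_C1_expsum _ _ _.
have cr2 : complex_C1 right2 _ := complex_C1_expsum _ _ _.
have cy0 : complex_C1 y0 y1 := complex_C1_cexp _.
have cy1 : complex_C1 y1 y2 := complex_C1Z _ cy0.
have cy2 : complex_C1 y2 _ := complex_C1Z _ cy1.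
have y01 : y0 0 = y0 1 by rewrite /y0 mulr0 cexp0 mulr1 hN.
have a1 : - 2^-1 < - sigma by lra.
have a2 : - sigma < sigma by lra.
have l0s : left0 (- sigma) = mid0 (- sigma).
  by rewrite /left0 /mid0 expsum_opp [RHS]expsum_opp opprK; symmetry; exact: match0.
have l1s : left1 (- sigma) = mid1 (- sigma).
  by rewrite /left1 /mid1 expsum_opp1 [RHS]expsum_opp1 opprK; congr (- _); symmetry; exact: match1.
have l0h : left0 (- 2^-1) = right0 2^-1 by rewrite /left0 expsum_opp opprK.
have l1h : left1 (- 2^-1) = right1 2^-1.
  by rewrite /left1 expsum_opp1 opprK -/right1 right1_half oppr0.
have exd : exists2 d : R, 0 < d <= 2^-1 & forall x, `|x| < d -> d <= sigma /\ mid0 x != 0.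
  (* For [|x| < d] one has [|k x| <= 1/8], so both exponentials lie within 1/2 of 1 and
     [|cos(k x)| >= 1/2]. *)
  pose d := Num.min sigma (8 * (nm k + 1))^-1.
  have k1 : 0 < 8 * (nm k + 1) by rewrite mulr_gt0// ltr_wpDl// nm_ge0.
  have d0 : 0 < d by rewrite lt_min s0 invr_gt0.
  have ds : d <= sigma by rewrite ge_min lexx.
  exists d; first by rewrite d0 (le_trans ds)// ltW.
  move=> x xd; split => //; rewrite mid0E mulf_neq0//.
  have kx : nm (k * x%:C%C) <= 8^-1.
    rewrite nmM nm_real; apply: (@le_trans _ _ ((nm k + 1) * (8 * (nm k + 1))^-1)).
      apply: ler_pM => //; rewrite ?nm_ge0 ?lerDl//.
      by apply: (le_trans (ltW xd)); rewrite ge_min lexx orbT.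
    have : nm k + 1 != 0 by rewrite gt_eqF// ltr_wpDl// nm_ge0.
    by move=> ?; rewrite invfM mulrCA divff ?mulr1.
  have i1 : nm ('i%C * (k * x%:C%C)) <= 8^-1 by rewrite nmM nm_i mul1r.
  have i2 : nm (- ('i%C * (k * x%:C%C))) <= 8^-1 by rewrite nmN.
  have c1e := cexp_sub1_lip (le_trans i1 (_ : 8^-1 <= 2^-1)).
  have c2e := cexp_sub1_lip (le_trans i2 (_ : 8^-1 <= 2^-1)).
  rewrite -nm_gt0 /ccos; set u := cexp _ in c1e *; set v := cexp _ in c2e *.
  have -> : (u + v) / 2 = 1 + ((u - 1) + (v - 1)) / 2 by field.
  have n2 : nm (2 : R[i]) = 2.
    by rewrite -[2%:R](rmorph_nat (real_complex R)) nm_real ger0_norm.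
  have := nm_subadd 1 (((u - 1) + (v - 1)) / 2); rewrite (Normc.normc1 R) nmM nmV n2.
  have := nmD (u - 1) (v - 1).
  have e1 : nm (u - 1) <= 4 * 8^-1 by apply: le_trans (c1e _) _; lra.
  have e2 : nm (v - 1) <= 4 * 8^-1 by apply: le_trans (c2e _) _; lra.
  lra.
have [d hd dm] := exd.
apply: (@separated_mode_spectrum R sigma B z
  (glue (- sigma) sigma left0 mid0 right0) (glue (- sigma) sigma left1 mid1 right1)
  (glue (- sigma) sigma left2 mid2 right2) y0 y1 y2 _ _ _ _ _ _ _ _ _ _ d hd).
- by apply: glue_lbm; apply: lC; [exact: cl0|exact: cm0|exact: cr0].
- by apply: glue_lbm; apply: lC; [exact: cl1|exact: cm1|exact: cr1].
- by apply: glue_lbm; apply: lC; [exact: cl2|exact: cm2|exact: cr2].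
- exact: lC cy0.
- exact: lC cy1.
- exact: lC cy2.
- exact: complex_ibp_on_glue.
- exact: complex_ibp_on_glue.
- move=> w; apply: complex_ibp_on_C1 => //; first exact: complex_C1Z.
  by rewrite y01.
- move=> w; apply: complex_ibp_on_C1 => //; first exact: complex_C1Z.
  by rewrite /y1 y01.
- move=> x xd; have [ds mx] := dm x xd; rewrite /glue.
  by move: xd; rewrite ltr_norml => /andP[x1 x2]; rewrite ltNge ifF ?ifT//; lra.
- by move=> y; exact: cexp_neq0.
- move=> x y; rewrite /damping /=.
  have yE : y2 y = - N%:C%C ^+ 2 * y0 y.
    have i2 : 'i%C * 'i%C = - 1 :> R[i] by rewrite -expr2 sqr_i.
    rewrite /y2 /y1; have -> : 'i%C * N%:C%C * ('i%C * N%:C%C * y0 y) =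
      'i%C * 'i%C * N%:C%C ^+ 2 * y0 y by ring.
    by rewrite i2; ring.
  (* In the outer strips the factor left over is [- ka^2 + B z - k^2], zero by [hka]; in the middle
     it is [k^2 - k^2]. *)
  rewrite hz yE /glue; have [xl|xl] := ltP x (- sigma).
    rewrite ifF; last by apply/negP; rewrite ler_norml; lra.
    rewrite /left2 expsum_deriv2 hka /left0; generalize (expsum c2 c1 ka x) (y0 y) => e f; ring.
  have [xr|xr] := leP x sigma.
    rewrite ifT; last by rewrite ler_norml xl xr.
    rewrite /mid2 expsum_deriv2 exprMn sqr_i /mid0; generalize (expsum m m a x) (y0 y) => e f; ring.
  rewrite ifF; last by apply/negP; rewrite ler_norml; lra.
  rewrite /right2 expsum_deriv2 hka /right0; generalize (expsum c1 c2 ka x) (y0 y) => e f; ring.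
Qed.

End ModeOfRoot.

(** * Resonances *)

Section Resonances.
Context {R : realType}.

Lemma cexp_2pi_nat (n : nat) : cexp ('i%C * (2 * pi * n%:R)%:C%C) = 1 :> R[i].
Proof.
have h : cexp ('i%C * (2 * pi)%:C%C) = 1 :> R[i].
  have -> : 'i%C * (2 * pi)%:C%C = (0 +i* (pi *+ 2))%C :> R[i].
    by apply: complex_eqP; rewrite ?cReM ?cImM /=; ring.
  by rewrite /cexp /= expR0 cos2pi sin2pi mulr1 mulr0.
elim: n => [|n ih]; first by rewrite mulr0 mulr0 cexp0.
by rewrite -(natr1 n) mulrDr mulr1 rmorphD mulrDr cexpD ih h mulr1.
Qed.

Lemma cexp_ipihalf : cexp ('i%C * (pi / 2)%:C%C) = 'i%C :> R[i].
Proof.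
have -> : 'i%C * (pi / 2)%:C%C = (0 +i* (pi / 2))%C :> R[i].
  by apply: complex_eqP; rewrite ?cReM ?cImM /=; ring.
by rewrite /cexp /= expR0 cos_pihalf sin_pihalf mulr1 mulr0.
Qed.

Lemma cexpN_ipihalf : cexp (- ('i%C * (pi / 2)%:C%C)) = - 'i%C :> R[i].
Proof.
have i2 : 'i%C * 'i%C = - 1 :> R[i] by rewrite -expr2 sqr_i.
have := cexpNr ('i%C * (pi / 2)%:C%C : R[i]); rewrite cexp_ipihalf => h.
apply: (mulfI (@ci_neq0 R)); rewrite h mulrN i2 opprK //.
Qed.

(** With the next lemma, this translates the equation for the deviation from [pi/(2 sigma)] into the
    characteristic equation for [k]. *)
Lemma csinDpihalf (a : R[i]) : csin ((pi / 2)%:C%C + a) = ccos a.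
Proof.
rewrite /csin /ccos mulrDr opprD !cexpD cexp_ipihalf cexpN_ipihalf.
by field; exact: ci_neq0.
Qed.

Lemma ccosDpihalf (a : R[i]) : ccos ((pi / 2)%:C%C + a) = - csin a.
Proof.
have i2 : 'i%C ^+ 2 = - 1 :> R[i] by rewrite sqr_i.
have i0 := @ci_neq0 R.
rewrite /csin /ccos mulrDr opprD !cexpD cexp_ipihalf cexpN_ipihalf.
apply: (mulfI i0); set u := cexp _; set v := cexp _.
have -> : 'i%C * (('i%C * u + - 'i%C * v) / 2) = 'i%C ^+ 2 * ((u - v) / 2) by field.
by rewrite i2; field.
Qed.

Lemma powR32 (x : R) : 0 < x -> x `^ (3 / 2) = x * Num.sqrt x.
Proof.
move=> x0; have -> : 3 / 2 = 1 + 2^-1 :> R by field.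
by rewrite powRD ?gt_eqF ?implybT// powRr1 ?ltW// powR12_sqrt// ltW.
Qed.

Lemma resonances_near (sigma B : R) : 0 < sigma < 2^-1 -> 0 < B ->
  exists C0 N0 : R, [/\ 0 < C0, 0 < N0 & forall n : nat, N0 <= n%:R ->
    exists z : R[i], [/\ spectrum (damping sigma B) z,
      `|complex.Im z - 2 * pi * n%:R| <= 1, 0 < complex.Im z &
      `|complex.Re z| <= C0 / (complex.Im z) `^ (3 / 2)]].
Proof.
move=> hs B0; have [s0 s1] := andP hs.
pose beta : R := Num.sqrt (B / 2); pose L := 2^-1 - sigma; pose k0 : R := pi / (2 * sigma).
have L0 : 0 < L by rewrite /L; lra.
have beta0 : 0 < beta by rewrite sqrtr_gt0; lra.
have betaB : 2 * beta ^+ 2 = B by rewrite sqr_sqrtr; lra.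
have s1' : sigma <= 1 by lra.
have [K [e1 [K0 e10 hK]]] := @resonant_point R sigma L beta B k0 s0 s1' L0 beta0 betaB.
have k00 : 0 < k0 by rewrite divr_gt0 ?pi_gt0// mulr_gt0.
have p2 := @pi_ge2 R.
(* [C0] multiplies the bounds [k0 + 1] of [|Re k|], [K N^(-1/2)] of [|Im k|] and [2 N^(1/2)] of the
   square root of [Im z]; adding 1 makes it positive even if [K = 0]. [N0] ensures [N^(-1/4) <= e1]
   and [N >= 2], hence [Im z > 0]. *)
exists (2 * (k0 + 1) * K + 1), (1 + e1 ^- 4).
have e14 : 0 < e1 ^- 4 by rewrite invr_gt0 exprn_gt0.
split=> [||n hn].
- by rewrite ltr_wpDl// !mulr_ge0//; lra.
- lra.
pose N : R := 2 * pi * n%:R.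
have nN : 2 * n%:R <= N by rewrite /N ler_wpM2r//; lra.
have N2 : 2 <= N by lra.
have Npos : 0 < N by lra.
pose r : R := Num.sqrt N^-1; pose e := Num.sqrt r.
have r0 : 0 < r by rewrite sqrtr_gt0 invr_gt0.
have e0 : 0 < e by rewrite sqrtr_gt0.
have e2 : e ^+ 2 = r by rewrite sqr_sqrtr// ltW.
have e4 : e ^+ 4 = N^-1.
  by rewrite (exprM e 2 2) e2 sqr_sqrtr// invr_ge0 ltW.
have ee1 : 0 < e <= e1.
  rewrite e0 -(ler_pXn2r (_ : (0 < 4)%N)) ?nnegrE ?(ltW e0) ?(ltW e10)// e4.
  rewrite -[leRHS]invrK lef_pV2 ?posrE//; lra.
have [th [ze [et]]] := hK e ee1; rewrite /= e4 invrK.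
set k := k0%:C%C + th; set z := N%:C%C * 'i%C + ze.
set ka := (beta / e ^+ 2)%:C%C * (1 + 'i%C) + et; set E := cexp _.
move=> [[th1 th2] ze1 E1 [hz hka] hroot].
have ksig : k * sigma%:C%C = (pi / 2)%:C%C + sigma%:C%C * th.
  have -> : pi / 2 = k0 * sigma by rewrite /k0; field; rewrite gt_eqF.
  by rewrite rmorphM /k; ring.
have spec : spectrum (damping sigma B) z.
  apply: (@mode_of_root R sigma B N z k ka hs (cexp_2pi_nat n) E1 hz hka).
  rewrite ksig csinDpihalf ccosDpihalf -/L -/E.
  apply/eqP; rewrite -subr_eq0; apply/eqP; rewrite -hroot; ring.
have Imz : complex.Im z = N + complex.Im ze.
  by rewrite cImD cImM /= mulr1 mul0r addr0.
have ImzN : `|complex.Im z - N| <= 1.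
  by rewrite Imz addrAC subrr add0r; exact: le_trans (nm_Im _) ze1.
have [Iz1 Iz2] : N - 1 <= complex.Im z /\ complex.Im z <= N + 1.
  by move: ImzN; rewrite ler_norml => /andP[]; lra.
have Iz0 : 0 < complex.Im z by lra.
exists z; split => //.
have key : complex.Re z * complex.Im z = - (complex.Re k * complex.Im k).
  have : complex.Im (z * z) + (complex.Im (N%:C%C * N%:C%C) + complex.Im (k * k)) = 0.
    by rewrite -!cImD -!expr2 hz addNr.
  by rewrite !cImM; set u := complex.Re z; set v := complex.Im z => /= ?; lra.
have Rek : `|complex.Re k| <= k0 + 1.
  rewrite cReD /=; apply: le_trans (ler_normD _ _) _; rewrite gtr0_norm// lerD2l.
  exact: le_trans (nm_Re _) th2.
have Imk : `|complex.Im k| <= K * r.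
  by rewrite cImD /= add0r -e2; exact: le_trans (nm_Im _) th1.
rewrite ler_pdivlMr ?powR_gt0// powR32// mulrA -[X in _ * X * _](gtr0_norm Iz0) -normrM key.
rewrite normrN normrM.
have h1 : `|complex.Re k| * `|complex.Im k| <= (k0 + 1) * (K * r) by exact: ler_pM.
have sq : Num.sqrt (complex.Im z) <= 2 * Num.sqrt N.
  have -> : 2 * Num.sqrt N = Num.sqrt (2 ^+ 2 * N).
    by rewrite (@sqrtrM _ (2 ^+ 2)) ?sqr_ge0// sqrtr_sqr ger0_norm.
  by rewrite ler_wsqrtr//; lra.
have rN : r * Num.sqrt N = 1.
  by rewrite -sqrtrM ?invr_ge0 ?ltW// mulVf ?gt_eqF// sqrtr1.
apply: (@le_trans _ _ ((k0 + 1) * (K * r) * (2 * Num.sqrt N))).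
  by apply: ler_pM => //; rewrite ?mulr_ge0 ?sqrtr_ge0.
have -> : (k0 + 1) * (K * r) * (2 * Num.sqrt N) = 2 * (k0 + 1) * K * (r * Num.sqrt N) by ring.
rewrite rN; lra.
Qed.

End Resonances.

Unset Implicit Arguments.

Theorem propositionB1 (R : realType) (sigma B : R)
    (hsigma : 0 < sigma < 2^-1) (hB : 0 < B) :
  exists2 C0 : R, 0 < C0 &
    exists z : nat -> R[i],
      [/\ injective z,
          forall i, spectrum (damping sigma B) (z i),
          complex.Im (z i) @[i --> \oo] --> +oo &
          forall i, 0 < complex.Im (z i) /\
            `|complex.Re (z i)| <= C0 / (complex.Im (z i)) `^ (3 / 2)].
Proof.
have [C0 [N0 [C00 N00 h]]] := resonances_near hsigma hB.
(* The sequence starts beyond the threshold: [N0 < n0 + 1]. *)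
pose n0 := Num.truncn N0.
have hn i : N0 <= (n0 + i).+1%:R.
  by apply: le_trans (ltW (truncnS_gt N0)) _; rewrite ler_nat ltnS leq_addr.
have [z hz] := choice (fun i => h _ (hn i)).
have p2 := @pi_ge2 R.
exists C0 => //; exists z; split.
(* Each [Im z] is within 1 of [2 pi n], and these centres are more than 2 apart; strict growth gives
   injectivity. *)
- have lt_Im i j : (i < j)%N -> complex.Im (z i) < complex.Im (z j).
    move=> ij; have [_ + _ _] := hz i; have [_ + _ _] := hz j.
    rewrite !ler_norml => /andP[a1 _] /andP[_ a2].
    have : (n0 + i).+1%:R + 1 <= (n0 + j).+1%:R :> R by rewrite natr1 ler_nat !ltnS ltn_add2l.
    nra.
  move=> i j zij; have [ij|ij|//] := ltngtP i j; [have := lt_Im _ _ ij|have := lt_Im _ _ ij];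
    by rewrite zij ltxx.
- by move=> i; have [] := hz i.
- apply/cvgryPge => A; near=> i.
  have [_ + _ _] := hz i; rewrite ler_norml => /andP[a1 _].
  have : A <= i%:R by near: i; exact: nbhs_infty_ger.
  have : i%:R + 1 <= (n0 + i).+1%:R :> R by rewrite natr1 ler_nat ltnS leq_addl.
  have : 0 <= i%:R :> R by [].
  nra.
- by move=> i; have [_ _ ? ?] := hz i.
Unshelve. all: by end_near.
Qed.
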